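(* Let $H$ be a monoid with quotient monoid $G$, $H\neq G$, and let $p$ and $r$ be finitary ideal systems on $H$ such that $p$ is modular and $p\leq r$. Let $\widetilde{r_p}$ be the $p$-modularization of $r$. (A) The following are equivalent: (1) $H$ is an $r$-almost Dedekind $r$-SP-monoid. (2) $r$-$\max(H)=t$-$\max(H)$ and the radical of every nontrivial principal ideal of $H$ is $t$-invertible. (3) $H$ is an $\widetilde{r_p}$-SP-monoid. (B) The following are equivalent: (1) $H$ is an $r$-Bézout $r$-SP-monoid. (2) $r$-$\max(H)=t$-$\max(H)$ and the radical of every principal ideal of $H$ is principal. (3) $H$ is an $\widetilde{r_p}$-Bézout $\widetilde{r_p}$-SP-monoid.
   Context: Monoids. A monoid $H$ is a commutative semigroup with identity and more than one element in which every nonzero element is cancellative. Here $z(H)=\{z\in H: zx=z \text{ for all } x\in H\}$ ($|z(H)|\le 1$, possibly empty); ''nonzero'' means not in $z(H)$; $H^{\bullet}=H\setminus z(H)$; $G=(H^{\bullet})^{-1}H$ is the quotient monoid; $\mathbb{N}$ is the set of positive integers. For $X\subseteq H$, $\sqrt X=\{x\in H: x^n\in X\text{ for some }n\in\mathbb{N}\}$; for $Y\subseteq G$, $Y^{-1}=\{z\in G: zY\subseteq H\}$. $X\subseteq H$ is an $s$-ideal if $X=XH\cup z(H)$; radical if $\sqrt X=X$; nontrivial if $z(H)\subsetneq X$; proper if $X\ne H$. A principal ideal is a set $AH\cup z(H)$ with $A\subseteq H$, $|A|\le 1$. A prime $s$-ideal is a proper $s$-ideal $P$ such that $xy\in P$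 implies $x\in P$ or $y\in P$; $H_P=(H\setminus P)^{-1}H$. Ideal systems. A finitary ideal system on $H$ is a map $r:\mathbb{P}(H)\to\mathbb{P}(H)$, $X\mapsto X_r$ such that for all $X,Y\subseteq H$, $c\in H$: $XH\cup z(H)\subseteq X_r$; $X\subseteq Y_r$ implies $X_r\subseteq Y_r$; $cX_r=(cX)_r$; $X_r=\bigcup_{E\subseteq X,|E|<\infty}E_r$. An $r$-ideal is an $X\subseteq H$ with $X_r=X$; it is $r$-invertible if $(XX^{-1})_r=H$; an $r$-ideal $I$ is $r$-finitely generated if $I=E_r$ for some finite $E\subseteq I$. The $r$-product of $r$-ideals $I,J$ is $(IJ)_r$ (similarly for finitely many factors). $r$-$\max(H)$ is the set of maximal elements among the proper $r$-ideals. $r$ is modular if $(I\cup J)_r\cap N\subseteq(I\cup(J\cap N))_r$ for all $r$-ideals $I,J,N$ with $I\subseteq N$. $p\le r$ means $X_p\subseteq X_r$ for all $X\subseteq H$. For $p\le r$, $\widetilde{r_p}$ is the map $X_{\widetilde{r_p}}=\{x\in H: xF\subseteq X_p\text{ and }F_r=H\text{ for some }F\subseteq H\}$; it is a finitary ideal system, called the $p$-modularization of $r$ when $p$ is modular. The $t$-system (for $H\ne G$) is $X_t=\bigcup_{E\subseteq X,|E|<\infty}E_v$ with $X_v=(X^{-1})^{-1}$; it is a finitary ideal system. Properties (for a finitary ideal system $q$ on $H$). If a monoid is different from its quotient monoid, it is a DVM (discrete valuation monoid) if all its $s$-ideals are principal. $H$ is $q$-almost Dedekind if $H=G$ or $H_M$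 is a DVM for each $M\in q$-$\max(H)$. $H$ is a $q$-SP-monoid if every $q$-ideal is a finite $q$-product of radical $q$-ideals. $H$ is $q$-Bézout if every nontrivial $q$-finitely generated $q$-ideal is principal. ''A $q$-almost Dedekind (resp. $q$-Bézout) $q$-SP-monoid'' means both properties hold. *)

(* Defs.v *)
From HB Require Import structures.
From mathcomp Require Import all_boot monoid generic_quotient.
From mathcomp Require Import boolp classical_sets functions cardinality.

Set Implicit Arguments.
Unset Strict Implicit.
Unset Printing Implicit Defensive.

Local Open Scope classical_set_scope.
Local Open Scope group_scope.
Local Open Scope quotient_scope.

Section SetOperations.
Variable H : monoidType.
Implicit Types X Y : set H.

(* z(H): empty, or the singleton of the absorbing element of H. *)
Definition zeros : set H := [set z | forall x : H, z * x = z].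

Definition set_mul X Y : set H := [set x * y | x in X & y in Y].

Definition radical X : set H := [set x | exists2 n, (0 < n)%N & X (x ^+ n)].

End SetOperations.

Arguments zeros : clear implicits.

HB.mixin Record Monoid_isCancMonoid H of Monoid H := {
  mulC_canc : commutative (@mul H);
  canc_nontrivial : exists x y : H, x <> y;
  canc_inj : forall a : H, ~ zeros H a -> injective (mul a)
}.

(* Commutative monoids with more than one element, in which every nonzero
   element is cancellative. *)
#[short(type="cancMonoidType")]
HB.structure Definition CancMonoid := {H of Monoid_isCancMonoid H & Monoid H}.

Arguments canc_inj {s} [a] _ _ _ _.

Section CancMonoidTheory.
Variable H : cancMonoidType.
Implicit Types a b x y : H.

Lemma zeros_neq_one : ~ zeros H 1.
Proof.
move=> z1; have [x [y]] := @canc_nontrivial H; apply.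
by rewrite -(mul1g x) -(mul1g y) !z1.
Qed.

Lemma zeros_mul a b : zeros H (a * b) -> zeros H a \/ zeros H b.
Proof.
move=> zab; case: (pselect (zeros H a)) => [|na]; first by left.
right=> x; apply: (canc_inj na).
by rewrite mulgA zab.
Qed.

End CancMonoidTheory.

(* Multiplicatively closed sets of nonzero elements: the denominators. *)
Record mulset (H : cancMonoidType) := Mulset {
  mulset_car :> set H;
  mulset1 : mulset_car 1;
  mulsetM : forall x y, mulset_car x -> mulset_car y -> mulset_car (x * y);
  mulset_nz : forall x, mulset_car x -> ~ zeros H x
}.

Section Localization.
Variables (H : cancMonoidType) (S : mulset H).

Definition fracs : Type := (H * set_type S)%type.
HB.instance Definition _ := Choice.on fracs.

Implicit Types u v w : fracs.

Definition den u : H := set_val u.2.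

Lemma denP u : mulset_car S (den u).
Proof. exact: set_valP. Qed.

Lemma den_nz u : ~ zeros H (den u).
Proof. exact/mulset_nz/denP. Qed.

Definition frac (x s : H) (hs : mulset_car S s) : fracs := (x, SigSub (mem_set hs)).

Lemma den_frac x s (hs : mulset_car S s) : den (frac x hs) = s.
Proof. by []. Qed.

(* x / s = y / t iff x t = y s; no extra factor is needed, since all the
   denominators are cancellative. *)
Definition frac_eq : rel fracs := fun u v => u.1 * den v == v.1 * den u.

Lemma frac_eq_refl : reflexive frac_eq.
Proof. by move=> u; rewrite /frac_eq eqxx. Qed.

Lemma frac_eq_sym : symmetric frac_eq.
Proof. by move=> u v; rewrite /frac_eq eq_sym. Qed.

Lemma frac_eq_trans : transitive frac_eq.
Proof.
move=> v u w /eqP uv /eqP vw; apply/eqP; apply: (canc_inj (@den_nz v)).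
rewrite [LHS]mulgA [den v * _]mulC_canc uv -mulgA [den u * _]mulC_canc mulgA vw.
by rewrite [RHS]mulC_canc -!mulgA [den u * _]mulC_canc.
Qed.

Canonical frac_equiv :=
  EquivRel frac_eq frac_eq_refl frac_eq_sym frac_eq_trans.

(* S^-1 H *)
Definition localization : Type := {eq_quot frac_equiv}.
HB.instance Definition _ := Choice.on localization.
HB.instance Definition _ := EqQuotient.on localization.

Lemma fracE u v :
  (\pi_localization u = \pi_localization v) <-> u.1 * den v = v.1 * den u.
Proof.
split=> [/eqP|h]; first by rewrite eqmodE => /eqP.
by apply/eqP; rewrite eqmodE; apply/eqP.
Qed.

Definition frac_mul u v : fracs :=
  frac (u.1 * v.1) (mulsetM (denP u) (denP v)).

Definition loc_frac (x s : H) (hs : mulset_car S s) : localization :=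
  \pi_localization (frac x hs).

Definition loc_one : localization := loc_frac 1 (mulset1 S).

Definition loc_mul (g h : localization) : localization :=
  \pi_localization (frac_mul (repr g) (repr h)).

Lemma loc_mulE u v :
  loc_mul (\pi_localization u) (\pi_localization v) =
  \pi_localization (frac_mul u v).
Proof.
apply/fracE; rewrite /frac_mul !den_frac /=.
have /fracE hu : \pi_localization (repr (\pi_localization u)) =
  \pi_localization u by rewrite reprK.
have /fracE hv : \pi_localization (repr (\pi_localization v)) =
  \pi_localization v by rewrite reprK.
have AC (a b c d : H) : (a * b) * (c * d) = (a * c) * (b * d).
  by rewrite -!mulgA; congr (_ * _); rewrite !mulgA [b * c]mulC_canc.
by rewrite AC hu hv AC.
Qed.

Lemma loc_ind (P : localization -> Prop) :
  (forall u, P (\pi_localization u)) -> forall g, P g.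
Proof. by move=> h g; rewrite -[g]reprK; apply: h. Qed.

Lemma loc_mulC : commutative loc_mul.
Proof.
elim/loc_ind=> u; elim/loc_ind=> v; rewrite !loc_mulE; apply/fracE => /=.
by rewrite !den_frac [v.1 * _]mulC_canc [den v * _]mulC_canc.
Qed.

Lemma loc_mulA : associative loc_mul.
Proof.
elim/loc_ind=> u; elim/loc_ind=> v; elim/loc_ind=> w.
by rewrite !loc_mulE; apply/fracE; rewrite /= !den_frac /= !mulgA.
Qed.

Lemma loc_mul1 : left_id loc_one loc_mul.
Proof.
elim/loc_ind=> u; rewrite loc_mulE; apply/fracE.
by rewrite /= !den_frac /= !mul1g.
Qed.

Lemma loc_mulr1 : right_id loc_one loc_mul.
Proof. by move=> g; rewrite loc_mulC loc_mul1. Qed.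

HB.instance Definition _ :=
  isMonoid.Build localization loc_mulA loc_mul1 loc_mulr1.

Definition loc_embed (x : H) : localization := loc_frac x (mulset1 S).

Lemma loc_embed_inj : injective loc_embed.
Proof. by move=> x y /fracE; rewrite /= !den_frac !mulg1. Qed.

Lemma loc_nontrivial : exists g h : localization, g <> h.
Proof.
have [x [y xy]] := @canc_nontrivial H.
by exists (loc_embed x), (loc_embed y) => /loc_embed_inj.
Qed.

Lemma loc_canc (g : localization) :
  ~ zeros localization g -> injective (mul g).
Proof.
elim/loc_ind: g => u nu.
have nz : ~ zeros H u.1.
  move=> zu; apply: nu; elim/loc_ind=> v.
  rewrite -[mul _ _]/(loc_mul _ _) loc_mulE; apply/fracE.
  by rewrite /= -mulgA !zu.
elim/loc_ind=> v; elim/loc_ind=> w.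
rewrite -![mul _ _]/(loc_mul _ _) !loc_mulE => /fracE.
rewrite /= !den_frac -!mulgA => /(canc_inj nz).
rewrite !mulgA ![_ * den u]mulC_canc -!mulgA => /(canc_inj (@den_nz u)).
by move=> h; apply/fracE.
Qed.

HB.instance Definition _ :=
  Monoid_isCancMonoid.Build localization loc_mulC loc_nontrivial loc_canc.

End Localization.

Section QuotientMonoid.
Variable H : cancMonoidType.

Lemma nonzeroM (x y : H) :
  (~` zeros H) x -> (~` zeros H) y -> (~` zeros H) (x * y).
Proof. by move=> nx ny /zeros_mul[]. Qed.

Definition nonzero_mulset : mulset H :=
  Mulset (@zeros_neq_one H) nonzeroM (fun _ hx => hx).

(* G, the quotient monoid of H *)
Definition quot : cancMonoidType := localization nonzero_mulset.

Definition quot_embed : H -> quot := @loc_embed H nonzero_mulset.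

(* H = G *)
Definition eq_quot_monoid : Prop := range quot_embed = setT.

(* Y^-1 = {z in G : zY is contained in H} *)
Definition frac_inv (Y : set quot) : set quot :=
  [set z | [set z * y | y in Y] `<=` range quot_embed].

End QuotientMonoid.

Arguments quot : clear implicits.
Arguments eq_quot_monoid : clear implicits.

Section Ideals.
Variable H : cancMonoidType.
Implicit Types X P : set H.

Definition s_ideal X : Prop := X = set_mul X setT `|` zeros H.

Definition nontrivial X : Prop := zeros H `<` X.

Definition proper_set X : Prop := X <> setT.

Definition principal X : Prop :=
  exists2 A : set H, is_subset1 A & X = set_mul A setT `|` zeros H.

Definition radical_set X : Prop := radical X = X.

Definition prime_s_ideal P : Prop :=
  [/\ s_ideal P, proper_set P & forall x y, P (x * y) -> P x \/ P y].


Lemma s_ideal_mul X x y : s_ideal X -> X x -> X (x * y).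
Proof. by move=> sX Xx; rewrite sX; left; exists x => //; exists y. Qed.

Lemma prime_compl1 P : prime_s_ideal P -> (~` P) 1.
Proof.
move=> [sP nP _] P1; apply: nP; apply/seteqP; split=> // x _.
by rewrite -(mul1g x); apply: s_ideal_mul.
Qed.

Lemma prime_complM P : prime_s_ideal P ->
  forall x y, (~` P) x -> (~` P) y -> (~` P) (x * y).
Proof. by move=> [_ _ pP] x y nx ny /pP[]. Qed.

Lemma prime_compl_nz P : prime_s_ideal P ->
  forall x, (~` P) x -> ~ zeros H x.
Proof. by move=> [sP _ _] x nx zx; apply: nx; rewrite sP; right. Qed.

Definition compl_mulset P (hP : prime_s_ideal P) : mulset H :=
  Mulset (prime_compl1 hP) (prime_complM hP) (prime_compl_nz hP).

(* H_P *)
Definition localization_at P (hP : prime_s_ideal P) : cancMonoidType :=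
  localization (compl_mulset hP).

End Ideals.

Definition DVM (H : cancMonoidType) : Prop :=
  ~ eq_quot_monoid H /\ forall X : set H, s_ideal X -> principal X.

Record ideal_system (H : cancMonoidType) := IdealSystem {
  cl :> set H -> set H;
  cl_sub : forall X, set_mul X setT `|` zeros H `<=` cl X;
  cl_closed : forall X Y, X `<=` cl Y -> cl X `<=` cl Y;
  cl_scale : forall (c : H) X, mul c @` cl X = cl (mul c @` X);
  cl_finitary : forall X,
    cl X = \bigcup_(E in [set E | E `<=` X /\ finite_set E]) cl E
}.

(* The notions below make sense for an arbitrary map q on sets, so that they
   apply to ideal systems as well as to the t-system and modularizations. *)
Section IdealSystems.
Variable H : cancMonoidType.
Implicit Types (q p r : set H -> set H) (X I J M N : set H).

Definition q_ideal q X : Prop := q X = X.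

Definition q_invertible q X : Prop :=
  q_ideal q X /\
  q (@quot_embed H @^-1`
      set_mul (@quot_embed H @` X) (frac_inv (@quot_embed H @` X))) = setT.

Definition q_fin_gen q I : Prop :=
  q_ideal q I /\ exists E, [/\ finite_set E, E `<=` I & I = q E].

Definition q_max q : set (set H) :=
  [set M | [/\ q_ideal q M, proper_set M &
     forall J, q_ideal q J -> proper_set J -> M `<=` J -> J = M]].

Definition modular q : Prop :=
  forall I J N, q_ideal q I -> q_ideal q J -> q_ideal q N -> I `<=` N ->
    q (I `|` J) `&` N `<=` q (I `|` (J `&` N)).

Definition le_system p r : Prop := forall X, p X `<=` r X.

(* modularization p r is the p-modularization of r *)
Definition modularization p r : set H -> set H := fun X =>
  [set x | exists F : set H, mul x @` F `<=` p X /\ r F = setT].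

Definition v_system : set H -> set H := fun X =>
  @quot_embed H @^-1` frac_inv (frac_inv (@quot_embed H @` X)).

Definition t_system : set H -> set H := fun X =>
  \bigcup_(E in [set E | E `<=` X /\ finite_set E]) v_system E.

(* The empty product, for n = 0, is q [set 1] = H. *)
Definition SP_monoid q : Prop :=
  forall I, q_ideal q I ->
    exists (n : nat) (J : 'I_n -> set H),
      (forall i, q_ideal q (J i) /\ radical_set (J i)) /\
      I = q (\big[@set_mul H/[set 1]]_(i < n) J i).

Definition Bezout q : Prop :=
  forall I, q_fin_gen q I -> nontrivial I -> principal I.

End IdealSystems.

Arguments t_system : clear implicits.

Section AlmostDedekind.
Variables (H : cancMonoidType) (r : ideal_system H).

Lemma sub_cl (X : set H) : X `<=` r X.
Proof.
by move=> x Xx; apply: cl_sub; left; exists x => //; exists 1 => //; rewrite mulg1.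
Qed.

Lemma q_max_prime (M : set H) : q_max r M -> prime_s_ideal M.
Proof.
move=> [rM pM maxM].
have sM : s_ideal M.
  apply/seteqP; split=> x.
    by move=> Mx; left; exists x => //; exists 1 => //; rewrite mulg1.
  by rewrite -[in X in _ -> X]rM; apply: cl_sub.
split=> // x y Mxy; case: (pselect (M x)) => Mx; first by left.
right.
have idem Z : r (r Z) = r Z.
  by apply/seteqP; split; [apply: cl_closed | apply: sub_cl].
have full : r (M `|` [set x]) = setT.
  apply: contrapT => np; apply: Mx.
  rewrite -(maxM (r (M `|` [set x]))) //; last by move=> z Mz; apply: sub_cl; left.
  by apply: sub_cl; right.
have : (mul y @` r (M `|` [set x])) y.
  by rewrite full; exists 1 => //; rewrite mulg1.
rewrite cl_scale -[in X in _ -> X]rM; apply: cl_closed => _ [z [Mz|->] <-].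
  by rewrite rM mulC_canc; apply: s_ideal_mul.
by rewrite rM mulC_canc.
Qed.

Definition almost_Dedekind : Prop :=
  eq_quot_monoid H \/
  forall (M : set H) (hM : q_max r M), DVM (localization_at (q_max_prime hM)).

End AlmostDedekind.

(* Main.v *)
Require Import Defs.
From mathcomp Require Import all_boot monoid boolp classical_sets functions.
From mathcomp Require Import cardinality.

Set Implicit Arguments.
Unset Strict Implicit.
Unset Printing Implicit Defensive.

Local Open Scope classical_set_scope.
Local Open Scope group_scope.

(** An element [x] of [H] belongs locally to [I], at a prime [M], when [f x] is
    in [I] for some [f] outside [M].  All the conditions compared below turn
    out to say that [H] has discrete valuations at the maximal r-ideals and
    that radicals of principal ideals are under control; the argument consists
    of passing between global statements on ideal systems and local
    divisibility.

    Once every maximal r-ideal [M] localizes to a discrete valuation monoid, a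
    finite set [E] has an element that locally divides all of [E]
    ([discrete_finite]).  Then the t-closure of [E] is locally contained in the
    principal ideal of that element, and as the modularization is a local
    closure, the systems [r], [t] and the modularization of [r] coincide
    ([discrete_systems_eq]).  So an SP-property is transferred between them for
    free, and the maximal ideals agree.  The radical of a nonzero [x H] is then
    t-invertible because it lies in a radical factor of [x H], which is
    invertible, and both have value one at [M] ([SP_radical_t_invertible]).

    If conversely the radicals of nonzero principal ideals are t-invertible,
    the ideals [A], [B] and their intersection, for radicals [A] and [B], are
    t-invertible, and a computation with fractional ideals shows that [A] and
    [B] are comparable at each maximal t-ideal [M] ([locally_comparable]).
    Since a radical ideal is never locally generated by a multiple of [e^2] with
    [e] in [M], the ideal [M] is locally generated by a generator of the radical
    of any of its nonzero elements [x] ([radical_generator]).  Division by the radical [X] of [x H]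
    lowers the values of an ideal [I] containing [x] by one wherever they
    are positive, whence [I] is the product of its radical and [(I : X)]; the
    process stops, as the iterated colon ideals cannot all lie in one
    maximal ideal ([SP_of_radical_generator]).

    The remaining implication is where modularity enters: a modular system with
    the SP-property has discrete valuations at its maximal ideals
    ([SP_discrete_at]).  If a prime [N] is not its own square, choose [x] in
    [N] outside [N^2]; an ideal in [N] that contains [x] has just one radical
    factor in [N], so the ideal of [x] and [y^2] is locally radical and contains [y]
    for [y] in [N], and the modular law yields that [x] divides [y]
    locally.  A prime with a local generator is a discrete valuation, since
    radical factors have value at most one.  Finally, a prime [N] minimal over
    a prime [P] and one more element [y] is not its own square: otherwise the
    ideals of [P] with [y] and of [P] with [y^2] would both be locally [N].  As
    there is no nonzero prime below a discrete valuation, every maximal ideal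
    is itself minimal over a nonzero element.

    For the Bezout version, finitely generated ideals of a Bezout system are
    principal, hence divisorial, so that [r] is [t], and a radical of a
    principal ideal is a finite intersection of principal radical factors,
    which exists as a least common multiple ([Bezout_radical_principal]).
    Conversely a generator of the radical of [x y] provides, for radical
    elements [x] and [y], a least common multiple, hence a greatest common
    divisor ([radical_gcd]); so finitely generated radical ideals are
    principal, and a finitely generated ideal is a product of such. *)

(** * Divisibility and finite sets in a cancellative monoid *)

Lemma mulgCA (H : cancMonoidType) (a b c : H) : a * (b * c) = b * (a * c).
Proof. by rewrite !mulgA (mulC_canc a). Qed.

(* Proves the equality of two products up to a permutation of their factors. *)
Ltac comm_mul :=
  rewrite -?mulgA;
  repeat lazymatch goal with
  | |- ?a = ?a => reflexivity
  | |- ?a * _ = ?a * _ => congr (_ * _)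
  | |- ?a * _ = _ =>
      first [rewrite [in RHS](mulgCA _ a) | rewrite [in RHS](mulC_canc _ a)]
  end.

Section Divisibility.
Variable H : cancMonoidType.
Implicit Types (a b c g h x y z : H) (X Y E : set H).

Definition multiples x : set H := [set y | exists u, y = x * u].

Lemma expgMn_canc x y n : (x * y) ^+ n = x ^+ n * y ^+ n.
Proof. by apply: expgMn; apply: mulC_canc. Qed.

Lemma zerosM_l a b : zeros H a -> zeros H (a * b).
Proof. by move=> az; rewrite az. Qed.

Lemma zerosM_r a b : zeros H b -> zeros H (a * b).
Proof. by move=> bz; rewrite mulC_canc bz. Qed.

Lemma nonzeroM_l a b : ~ zeros H (a * b) -> ~ zeros H a.
Proof. by move=> + az; apply; apply: zerosM_l. Qed.

Lemma nonzeroM_r a b : ~ zeros H (a * b) -> ~ zeros H b.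
Proof. by move=> + bz; apply; apply: zerosM_r. Qed.

Lemma nonzeroX a n : ~ zeros H a -> ~ zeros H (a ^+ n).
Proof.
by move=> na; elim: n => [|n IHn]; [apply: zeros_neq_one
  | rewrite expgS; apply: nonzeroM].
Qed.

Lemma multiples_refl x : multiples x x.
Proof. by exists 1; rewrite mulg1. Qed.

Lemma multiplesM x u : multiples x (x * u).
Proof. by exists u. Qed.

Lemma multiples_mulr x y z : multiples x y -> multiples x (y * z).
Proof. by move=> [u ->]; exists (u * z); rewrite mulgA. Qed.

Lemma multiples_mull x y z : multiples x y -> multiples x (z * y).
Proof. by rewrite mulC_canc; apply: multiples_mulr. Qed.

Lemma multiples_trans x y z : multiples x y -> multiples y z -> multiples x z.
Proof. by move=> xy [u ->]; apply: multiples_mulr. Qed.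

Lemma multiples_cancel a x y :
  ~ zeros H a -> multiples (a * x) (a * y) -> multiples x y.
Proof. by move=> na [u]; rewrite -mulgA => /(canc_inj na) ->; exists u. Qed.

Lemma multiples_scale a x y : multiples x y -> multiples (a * x) (a * y).
Proof. by move=> [u ->]; exists u; rewrite mulgA. Qed.

Lemma multiples_zero x z : zeros H z -> multiples x z.
Proof. by move=> zz; exists z; rewrite mulC_canc zz. Qed.

Lemma multiples_of_zero x : zeros H x -> multiples x = zeros H.
Proof.
move=> zx; apply/seteqP; split=> y; last exact: multiples_zero.
by move=> [u ->]; apply: zerosM_l.
Qed.

Lemma principalP X :
  principal X <-> X = zeros H \/ exists2 x, ~ zeros H x & X = multiples x.
Proof.
split=> [[A A1 ->]|].
  case: (pselect (exists2 a, A a & ~ zeros H a)) => [[a Aa na]|nA].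
    right; exists a => //; apply/seteqP; split=> y.
      by case=> [[b Ab [u _ <-]]|/multiples_zero//]; rewrite (A1 _ _ Ab Aa);
        exists u.
    by move=> [u ->]; left; exists a => //; exists u.
  left; apply/seteqP; split=> y; last by right.
  case=> // -[a Aa [u _ <-]]; apply: zerosM_l.
  by apply: contrapT => na; apply: nA; exists a.
case=> [->|[x nx ->]].
  exists set0 => //; apply/seteqP; split=> y; first by right.
  by case=> // -[].
exists [set x] => [_ _ -> -> //|]; apply/seteqP; split=> y.
  by move=> [u ->]; left; exists x => //; exists u.
by case=> [[_ -> [u _ <-]]|/multiples_zero//]; exists u.
Qed.

Lemma principal_multiples x : principal (multiples x).
Proof.
apply/principalP; case: (pselect (zeros H x)) => [/multiples_of_zero|nx].
  by left.
by right; exists x.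
Qed.

Lemma nontrivial_multiples x : ~ zeros H x -> nontrivial (multiples x).
Proof.
move=> nx; split; first by move=> z /multiples_zero.
by move=> /(_ x (multiples_refl x)).
Qed.

Lemma nontrivial_principal X :
  principal X -> nontrivial X -> exists2 x, ~ zeros H x & X = multiples x.
Proof. by move=> /principalP[-> [_ /(_ (fun _ => id))]|]. Qed.

Lemma radicalS X Y : X `<=` Y -> radical X `<=` radical Y.
Proof. by move=> XY x [n n0 /XY Yx]; exists n. Qed.

Lemma sub_radical X : X `<=` radical X.
Proof. by move=> x Xx; exists 1%N. Qed.

Lemma radicalK X : radical (radical X) = radical X.
Proof.
apply/seteqP; split; last exact: sub_radical.
move=> x [n n0 [m m0]]; rewrite -expgnA => Xx.
by exists (n * m)%N => //; rewrite muln_gt0 n0.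
Qed.

Lemma radicalX X x n : radical_set X -> X (x ^+ n.+1) -> X x.
Proof. by move=> rX Xx; rewrite -rX; exists n.+1. Qed.

Lemma set_mulP X Y x y : X x -> Y y -> set_mul X Y (x * y).
Proof. by move=> Xx Yy; exists x => //; exists y. Qed.

Lemma set_mulC : commutative (@set_mul H).
Proof.
by move=> X Y; apply/seteqP; split=> z [x Xx [y Yy <-]];
  rewrite mulC_canc; apply: set_mulP.
Qed.

Lemma set_mulA : associative (@set_mul H).
Proof.
move=> X Y Z; apply/seteqP; split=> w.
  by move=> [x Xx [_ [y Yy [z Zz <-]] <-]]; rewrite mulgA; do 2?apply: set_mulP.
by move=> [_ [x Xx [y Yy <-]] [z Zz <-]]; rewrite -mulgA; do 2?apply: set_mulP.
Qed.

Lemma set_mul1 X : set_mul X [set 1] = X.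
Proof.
apply/seteqP; split=> z; first by move=> [x Xx [_ -> <-]]; rewrite mulg1.
by move=> Xz; exists z => //; exists 1 => //; rewrite mulg1.
Qed.

(** Ideal systems being finitary, directed unions of ideals are ideals, and
    conditions on infinitely many elements reduce to one member of a
    directed family, by this lemma. *)
Lemma finite_directed (I : Type) (R : set I) (D : I -> set H) E :
  R !=set0 ->
  (forall i j, R i -> R j -> exists2 k, R k & D i `|` D j `<=` D k) ->
  finite_set E -> E `<=` \bigcup_(i in R) D i ->
  exists2 k, R k & E `<=` D k.
Proof.
move=> [i0 Ri0] dirD /finite_seqP[s ->]; elim: s => [|e s IHs] sub.
  by exists i0 => // x; rewrite /= in_nil.
have [|k Rk Dk] := IHs; first by move=> x xs; apply: sub;
  rewrite /= in_cons [X in _ || X]xs orbT.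
have [|j Rj Dj] := sub e; first by rewrite /= in_cons eqxx.
have [l Rl Dl] := dirD k j Rk Rj; exists l => // x /=.
by rewrite in_cons => /orP[/eqP->|xs]; apply: Dl; [right|left; apply: Dk].
Qed.

Definition finite_subsets X : set (set H) :=
  [set E | E `<=` X /\ finite_set E].

Lemma finite_subsets0 X : finite_subsets X !=set0.
Proof. by exists set0; split=> //; apply: finite_set0. Qed.

Lemma finite_subsets_directed X (D : set H -> set H) :
  (forall E F, E `<=` F -> D E `<=` D F) ->
  forall E F, finite_subsets X E -> finite_subsets X F ->
  exists2 G, finite_subsets X G & D E `|` D F `<=` D G.
Proof.
move=> monoD E F [EX finE] [FX finF]; exists (E `|` F).
  by split; [move=> y [/EX|/FX] | rewrite finite_setU].
by move=> y [|]; apply: monoD => z; [left|right].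
Qed.

End Divisibility.

(** * Finitary ideal systems *)

Section IdealSystemTheory.
Variables (H : cancMonoidType) (q : ideal_system H).
Implicit Types (c x y z : H) (X Y E I J N S : set H).

Lemma cl_mono X Y : X `<=` Y -> q X `<=` q Y.
Proof. by move=> XY; apply: cl_closed => x /XY; apply: sub_cl. Qed.

Lemma cl_idem X : q_ideal q (q X).
Proof. by apply/seteqP; split; [apply: cl_closed | apply: sub_cl]. Qed.

Lemma cl_min I X : q_ideal q I -> X `<=` I -> q X `<=` I.
Proof. by move=> qI XI; rewrite -[X in _ `<=` X]qI; apply: cl_mono. Qed.

Lemma q_idealI I : q I `<=` I -> q_ideal q I.
Proof. by move=> qI; apply/seteqP; split=> //; apply: sub_cl. Qed.

Lemma zeros_sub_cl X : zeros H `<=` q X.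
Proof. by move=> z zz; apply: cl_sub; right. Qed.

Lemma ideal_zeros I : q_ideal q I -> zeros H `<=` I.
Proof. by move=> <-; apply: zeros_sub_cl. Qed.

Lemma ideal_mulr I x y : q_ideal q I -> I x -> I (x * y).
Proof.
by move=> qI Ix; rewrite -qI; apply: cl_sub; left; exists x => //; exists y.
Qed.

Lemma ideal_mull I x y : q_ideal q I -> I x -> I (y * x).
Proof. by rewrite mulC_canc; apply: ideal_mulr. Qed.

Lemma ideal_s_ideal I : q_ideal q I -> s_ideal I.
Proof.
move=> qI; apply/seteqP; split=> x.
  by move=> Ix; left; exists x => //; exists 1 => //; rewrite mulg1.
by case=> [[y Iy [u _ <-]]|]; [apply: ideal_mulr | apply: ideal_zeros].
Qed.

Lemma ideal_multiples_sub I x : q_ideal q I -> I x -> multiples x `<=` I.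
Proof. by move=> qI Ix _ [u ->]; apply: ideal_mulr. Qed.

Lemma ideal1 I : q_ideal q I -> I 1 -> I = setT.
Proof.
by move=> qI I1; apply/seteqP; split=> // x _; rewrite -(mul1g x);
  apply: ideal_mulr.
Qed.

Lemma cl_one X : q X 1 -> q X = setT.
Proof. by apply: ideal1; apply: cl_idem. Qed.

Lemma cl1 : q [set 1] = setT.
Proof. by apply: cl_one; apply: sub_cl. Qed.

Lemma cl_fin X x : q X x -> exists E, [/\ finite_set E, E `<=` X & q E x].
Proof. by rewrite cl_finitary => -[E [EX fE] Ex]; exists E. Qed.

Lemma cl_scaled c X x : q X x -> q (mul c @` X) (c * x).
Proof. by move=> Xx; rewrite -cl_scale; exists x. Qed.

Lemma ideal_multiples x : q_ideal q (multiples x).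
Proof.
have -> : multiples x = mul x @` q setT.
  by apply/seteqP; split=> y [u]; [move=> ->; exists u => //; apply: sub_cl
    | move=> _ <-; exists u].
by rewrite cl_scale; apply: cl_idem.
Qed.

Lemma cl_set1 x : q [set x] = multiples x.
Proof.
apply/seteqP; split; first apply: cl_min; first exact: ideal_multiples.
  by move=> _ ->; apply: multiples_refl.
by apply: ideal_multiples_sub; [apply: cl_idem | apply: sub_cl].
Qed.

Definition colon I X : set H := [set z | forall x, X x -> I (z * x)].

Lemma ideal_colon I X : q_ideal q I -> q_ideal q (colon I X).
Proof.
move=> qI; apply: q_idealI => z + x Xx.
rewrite mulC_canc => /(cl_scaled x); apply: cl_min => // _ [y Cy <-].
by rewrite mulC_canc; apply: Cy.
Qed.

Lemma sub_colon I X : q_ideal q I -> I `<=` colon I X.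
Proof. by move=> qI z Iz x _; apply: ideal_mulr. Qed.

Lemma cl_set_mull X Y : q (set_mul (q X) Y) = q (set_mul X Y).
Proof.
apply/seteqP; split; last first.
  by apply: cl_mono => _ [x Xx [y Yy <-]]; apply: set_mulP; first apply: sub_cl.
apply: cl_min; first exact: cl_idem.
move=> _ [x Xx [y Yy <-]].
suff : colon (q (set_mul X Y)) Y x by apply.
move: Xx; apply: cl_min; first by apply: ideal_colon; apply: cl_idem.
by move=> x' Xx' y' Yy'; apply: sub_cl; apply: set_mulP.
Qed.

Lemma cl_set_mulr X Y : q (set_mul X (q Y)) = q (set_mul X Y).
Proof. by rewrite set_mulC cl_set_mull set_mulC. Qed.

Lemma ideal_directed (T : Type) (R : set T) (D : T -> set H) :
  R !=set0 ->
  (forall i j, R i -> R j -> exists2 k, R k & D i `|` D j `<=` D k) ->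
  (forall i, R i -> q_ideal q (D i)) -> q_ideal q (\bigcup_(i in R) D i).
Proof.
move=> R0 dirD qD; apply: q_idealI => x /cl_fin[E [finE ED Ex]].
have [k Rk EDk] := finite_directed R0 dirD finE ED.
by exists k => //; move: Ex; apply: cl_min => //; apply: qD.
Qed.

Definition mul_closed S := S 1 /\ forall x y, S x -> S y -> S (x * y).

(** The trace on [H] of the localization of [I] at [S]. *)
Definition local_part S I : set H := [set z | exists2 f, S f & I (f * z)].

Lemma ideal_local_part S I :
  mul_closed S -> q_ideal q I -> q_ideal q (local_part S I).
Proof.
move=> [S1 SM] qI.
have -> : local_part S I = \bigcup_(f in S) colon I [set f].
  apply/seteqP; split=> z [f Sf If]; exists f => //.
    by move=> _ ->; rewrite mulC_canc.
  by rewrite mulC_canc; apply: If.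
apply: ideal_directed; first by exists 1.
  move=> f g Sf Sg; exists (f * g); first exact: SM.
  move=> z [] Iz _ ->; [rewrite mulgA|rewrite mulgCA mulC_canc];
    by apply: ideal_mulr => //; apply: Iz.
by move=> f _; apply: ideal_colon.
Qed.

Definition avoids I S := forall x, S x -> ~ I x.

(** Krull's separation lemma. *)
Lemma maximal_avoiding I S : q_ideal q I -> mul_closed S -> avoids I S ->
  exists N, [/\ q_ideal q N, I `<=` N, avoids N S,
    forall J, q_ideal q J -> N `<=` J -> avoids J S -> J = N
    & forall x y, N (x * y) -> N x \/ N y].
Proof.
move=> qI [S1 SM] IS.
(* [A] ranges over sets to be added to [I], so that the empty chain is
   harmless. *)
pose P A := avoids (q (I `|` A)) S.
have [|A [PA maxA]] := @Zorn_bigcup H P.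
  move=> F FP totF s Ss /cl_fin[E [finE EF Es]].
  case: (pselect (F !=set0)) => [F0|F0].
    have [|//|A FA EA] := @finite_directed _ _ F (fun A => I `|` A) E F0 _ finE.
    - move=> A B FA FB; case: (totF A B FA FB) => AB.
        by exists B => // x [[]|[]] ?; [left|right; apply: AB|left|right].
      by exists A => // x [[]|[]] ?; [left|right|left|right; apply: AB].
    - move=> x /EF[Ix|[A FA Ax]]; last by exists A => //; right.
      by have [A FA] := F0; exists A => //; left.
    - by apply: (FP A FA s Ss); move: Es; apply: cl_mono.
  apply: (IS s Ss); move: Es; apply: cl_min => // x /EF[//|[A FA]].
  by case: F0; exists A.
pose N := q (I `|` A).
have qN : q_ideal q N by apply: cl_idem.
have IN : I `<=` N by move=> x Ix; apply: sub_cl; left.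
have NA : N `<=` A.
  have AN : A `<=` N by move=> x Ax; apply: sub_cl; right.
  have NP : P N.
    move=> s Ss Ns; apply: (PA s Ss); move: Ns; apply: cl_min => // x [/IN|] //.
  by move=> x Nx; apply: contrapT => nAx; apply: (maxA N) => //;
    split=> // /(_ x Nx).
have maxN J : q_ideal q J -> N `<=` J -> avoids J S -> J = N.
  move=> qJ NJ JS; apply/seteqP; split=> // x Jx; apply: contrapT => nNx.
  apply: (maxA J).
    split; first by move=> y Ay; apply: NJ; apply: sub_cl; right.
    by move=> /(_ x Jx) Ax; apply: nNx; apply: sub_cl; right.
  move=> s Ss Js; apply: (JS s Ss); move: Js;
    apply: cl_min => // y [/IN/NJ|] //.
exists N; split=> // x y Nxy; apply: contrapT => /not_orP[nNx nNy].
have meet z : ~ N z -> exists2 s, S s & q (N `|` [set z]) s.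
  move=> nNz; apply: contrapT => nS; apply: nNz.
  rewrite -(maxN (q (N `|` [set z]))); first by apply: sub_cl; right.
  - exact: cl_idem.
  - by move=> w Nw; apply: sub_cl; left.
  - by move=> s Ss Ns; apply: nS; exists s.
have [s Ss Ns] := meet x nNx; have [t St Nt] := meet y nNy.
apply: (PA (s * t) (SM _ _ Ss St)).
have cN w : q (N `|` [set x]) w -> N (w * y).
  move=> Nw; suff: colon N [set y] w by apply.
  move: Nw; apply: cl_min; first exact: ideal_colon.
  by move=> u [Nu|->] _ ->; first apply: ideal_mulr.
suff: colon N [set s] t by move=> /(_ s erefl); rewrite mulC_canc.
move: Nt; apply: cl_min; first exact: ideal_colon.
by move=> u [Nu|->] _ ->; [apply: ideal_mulr | rewrite mulC_canc; apply: cN].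
Qed.

Definition prime_ideal N :=
  [/\ q_ideal q N, ~ N 1 & forall x y, N (x * y) -> N x \/ N y].

Lemma prime_mul_closed N : prime_ideal N -> mul_closed (~` N).
Proof. by move=> [_ N1 pN]; split=> // x y nNx nNy /pN[]. Qed.

Lemma primeX N x n : prime_ideal N -> N (x ^+ n) -> N x.
Proof.
move=> pN Nx; apply: contrapT => nNx; move: Nx;
  case: (prime_mul_closed pN) => n1 nM.
by elim: n => // n IHn; rewrite expgS; apply: nM.
Qed.

Lemma prime_avoiding I S : q_ideal q I -> mul_closed S -> avoids I S ->
  exists N, [/\ prime_ideal N, I `<=` N & avoids N S].
Proof.
move=> qI mS IS; have [N [qN IN NS _ pN]] := maximal_avoiding qI mS IS.
by exists N; split=> //; split=> //; apply: NS; case: mS.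
Qed.

Lemma q_maxP M : q_max q M -> prime_ideal M.
Proof.
move=> MM; have [_ nM pM] := q_max_prime MM; have [qM _ _] := MM.
by split=> // M1; apply: nM; apply: ideal1.
Qed.

Lemma q_max_exists I : q_ideal q I -> ~ I 1 -> exists2 M, q_max q M & I `<=` M.
Proof.
move=> qI nI1; have m1 : mul_closed [set 1].
  by split=> // x y -> ->; rewrite mulg1.
have [|M [qM IM MS maxM _]] := maximal_avoiding qI m1; first by move=> _ ->.
exists M => //; split=> //; first by move=> M1; apply: (MS 1) => //; rewrite M1.
by move=> J qJ pJ MJ; apply: maxM => // _ -> J1; apply: pJ; apply: ideal1.
Qed.

(** An ideal lying in no maximal ideal is everything. *)
Lemma ideal_top I : q_ideal q I ->
  (forall M, q_max q M -> exists2 f, ~ M f & I f) -> I 1.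
Proof.
move=> qI nM; apply: contrapT => /(q_max_exists qI)[M MM IM].
by have [f nMf /IM] := nM M MM.
Qed.

Lemma ideal_radical I : q_ideal q I -> q_ideal q (radical I).
Proof.
move=> qI; apply: q_idealI => z Rz; apply: contrapT => nRz.
have mz : mul_closed [set z ^+ n | n in setT].
  by split=> [|_ _ [n _ <-] [m _ <-]]; [exists 0%N | exists (n + m)%N => //;
    rewrite expgnDr].
have [|N [pN IN Nz]] := prime_avoiding qI mz.
  move=> _ [[|n] _ <-] Iz; last by apply: nRz; exists n.+1.
  by apply: nRz; exists 1%N => //; rewrite -(mul1g z); apply: ideal_mulr.
apply: (Nz z); first by exists 1%N.
move: Rz; apply: cl_min; first by case: pN.
by move=> x [n _ /IN]; apply: primeX.
Qed.

Definition minimal_over N I :=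
  I `<=` N /\ forall z, N z -> exists f n, ~ N f /\ I (f * z ^+ n).

Lemma minimal_prime_exists I M : q_ideal q I -> prime_ideal M -> I `<=` M ->
  exists N, [/\ prime_ideal N, N `<=` M & minimal_over N I].
Proof.
move=> qI pM IM.
(* The complements of the primes sought are the maximal multiplicative sets
   that avoid [I]. *)
pose P S := S = set0 \/ [/\ mul_closed S, ~` M `<=` S & avoids I S].
have mM := prime_mul_closed pM.
have [|S [PS maxS]] := @Zorn_bigcup H P.
  move=> F FP totF;
    case: (pselect (exists2 S, F S & S !=set0)) => [[S0 FS0 [x0 S0x0]]|F0].
    have good S : F S -> S !=set0 -> [/\ mul_closed S, ~` M `<=` S &
      avoids I S].
      by move=> /FP[->|//] [x []].
    have S0n : S0 !=set0 by exists x0.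
    have [[S01 _] MS0 _] := good _ FS0 S0n.
    right; split.
    - split; first by exists S0.
      move=> x y [A FA Ax] [B FB By]; case: (totF A B FA FB) => AB.
        have [|[_ BM] _ _] := good B FB; first by exists y.
        by exists B => //; apply: BM => //; apply: AB.
      have [|[_ AM] _ _] := good A FA; first by exists x.
      by exists A => //; apply: AM => //; apply: AB.
    - by move=> x /MS0 S0x; exists S0.
    - move=> x [A FA Ax]; have [|_ _] := good A FA; first by exists x.
      exact.
  left; apply/seteqP; split=> // x [S FS Sx]; apply: F0; exists S => //;
    by exists x.
have [mS MS IS] : [/\ mul_closed S, ~` M `<=` S & avoids I S].
  case: PS => // S0; exfalso; apply: (maxS (~` M)).
    by rewrite S0; split=> // /(_ 1); apply; case: mM.
  by right; split=> // x nMx /IM.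
have [N [pN IN NS]] := prime_avoiding qI mS IS.
have [_ nN1 _] := pN; have mN := prime_mul_closed pN.
have SN : S = ~` N.
  apply/seteqP; split=> // x nNx; apply: contrapT => nSx; apply: (maxS (~` N)).
    by split; [move=> y /NS | move=> /(_ x nNx)].
  by right; split=> // y; [move=> /MS/NS | move=> nNy /IN].
exists N; split=> //; first by move=> x Nx; apply: contrapT => /MS/NS.
split=> // z Nz.
pose S' := [set x | exists f n, ~ N f /\ x = f * z ^+ n].
apply: contrapT => nz; apply: (maxS S').
  split; first by rewrite SN => f nNf; exists f, 0%N; rewrite mulg1.
  move=> /(_ z); rewrite SN; apply=> //.
  by exists 1, 1%N; split=> //; rewrite mul1g.
right; split.
- split; first by exists 1, 0%N; rewrite mulg1.
  move=> _ _ [f [n [nf ->]]] [g [m [ng ->]]]; exists (f * g), (n + m)%N.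
  split; first exact: mN.2.
  by rewrite expgnDr; comm_mul.
- by move=> f /MS; rewrite SN => nf; exists f, 0%N; rewrite mulg1.
- by move=> _ [f [n [nf ->]]] If; apply: nz; exists f, n.
Qed.

(** * Products of radical ideals *)

Implicit Types (a b f g : H) (K L M P : set H).

(** The finite products of radical [q]-ideals, presented inductively so that
    the factors can be split off one at a time. *)
Inductive factored : set H -> Prop :=
| factored1 : factored [set 1]
| factoredM J K : q_ideal q J -> radical_set J -> factored K ->
    factored (set_mul J K).

Lemma SP_monoidP :
  SP_monoid q <-> forall I, q_ideal q I -> exists2 K, factored K & I = q K.
Proof.
split=> SP I /SP.
  move=> [n [J [radJ ->]]]; exists (\big[@set_mul H/[set 1]]_(i < n) J i) => //.
  elim: n J radJ => [|n IHn] J radJ; first by rewrite big_ord0;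
    apply: factored1.
  by rewrite big_ord_recl; case: (radJ ord0) => qJ rJ; apply: factoredM => //;
    apply: IHn => i; apply: radJ.
move=> [K fK ->].
suff [n [J [radJ ->]]] : exists n (J : 'I_n -> set H),
    (forall i, q_ideal q (J i) /\ radical_set (J i)) /\
    K = \big[@set_mul H/[set 1]]_(i < n) J i by exists n, J.
elim: fK => {K} [|J K qJ rJ _ [n [J' [radJ' ->]]]].
  by exists 0%N, (fun=> setT); split; [case|rewrite big_ord0].
exists n.+1, (fun i => if unlift ord0 i is Some j then J' j else J); split.
  by move=> i; case: unliftP.
rewrite big_ord_recl unlift_none; congr set_mul.
by apply: eq_bigr => i _; rewrite liftK.
Qed.

Lemma set_mul_subl J X : q_ideal q J -> set_mul J X `<=` J.
Proof. by move=> qJ _ [y Jy [x _ <-]]; apply: ideal_mulr. Qed.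

(** [J] localizes at [N] to a principal ideal; for an ideal that is not zero this
    says that [J J^-1] is not contained in [N]. *)
Definition invertible_at N J :=
  exists a s, [/\ J a, ~ N s & forall y, J y -> multiples a (s * y)].

Definition generates N x :=
  N x /\ forall y, N y -> exists2 f, ~ N f & multiples x (f * y).

(** The localization at [N] is a discrete valuation monoid in which [x] has
    value one; that it is one in the sense of [DVM] is shown by
    [DVM_of_discrete]. *)
Definition discrete_at N := exists x, [/\ ~ zeros H x, generates N x
  & forall b, ~ zeros H b -> exists n, exists2 f, ~ N f &
    multiples b (f * x ^+ n)].

(** The products of elements of the two factors cannot all lie in [b N], and an
    [a l] outside [b N] makes [a] a local generator of [J]. *)
Lemma invertible_factor N J L b : q_ideal q N -> ~ N 1 -> ~ zeros H b ->
  q (set_mul J L) = multiples b -> invertible_at N J.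
Proof.
move=> qN nN1 nb JLb.
have [a [l [Ja Ll nal]]] : exists a l, [/\ J a, L l & ~ (mul b @` N) (a * l)].
  apply: contrapT => nJL; apply: nN1.
  have JLN : q (set_mul J L) `<=` mul b @` N.
    rewrite -[in X in _ `<=` X]qN cl_scale;
      apply: cl_mono => _ [a Ja [l Ll <-]].
    by apply: contrapT => nal; apply: nJL; exists a, l.
  have /JLN[u Nu] : q (set_mul J L) b by rewrite JLb; apply: multiples_refl.
  by rewrite -{2}(mulg1 b) => /(canc_inj nb) <-.
have bJL y l' : J y -> L l' -> multiples b (y * l').
  by move=> Jy Ll'; rewrite -JLb; apply: sub_cl; apply: set_mulP.
have [s als] := bJL a l Ja Ll; exists a, s; split=> //.
  by move=> Ns; apply: nal; exists s.
move=> y Jy; have [w ylw] := bJL y l Jy Ll; exists w; apply: (canc_inj nb).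
rewrite [LHS]mulgA -als.
transitivity (a * (y * l)); first by comm_mul.
by rewrite ylw; comm_mul.
Qed.

(** A radical factor contained in [N] has value one at [N]: if its local
    generator [a] were locally divisible by [x ^+ 2], then the square of [a / x]
    would be a multiple of [a], and the factor would contain [a / x]. *)
Lemma radical_factor_value N J L b x : prime_ideal N -> ~ zeros H b ->
  generates N x -> q_ideal q J -> radical_set J ->
  q (set_mul J L) = multiples b -> J `<=` N ->
  exists2 a, J a & exists2 f, ~ N f & multiples a (f * x).
Proof.
move=> pN nb [Nx gx] qJ rJ JLb JN; have mN := prime_mul_closed pN.
have [qN nN1 prN] := pN.
have [a [s [Ja nNs aJ]]] := invertible_factor qN nN1 nb JLb.
have na : ~ zeros H a.
  move=> za; apply: nb; suff: q (set_mul J L) `<=` zeros H.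
    by apply; rewrite JLb; apply: multiples_refl.
  rewrite -(multiples_of_zero za); apply: cl_min; first exact: ideal_multiples.
  move=> _ [y Jy [l _ <-]]; apply: multiples_mulr.
  have := aJ y Jy; rewrite multiples_of_zero // => zsy.
  case: (zeros_mul zsy) => // zs.
  by case: nNs; apply: (ideal_zeros qN).
exists a => //; have [f nNf [h fa]] := gx a (JN a Ja).
case: (pselect (N h)) => [Nh|nNh]; last by exists h => //; exists f;
  rewrite mulC_canc -fa mulC_canc.
have [g nNg [k gh]] := gx h Nh.
(* [f g a = x^2 k], so [x k] has its square in [a H] *)
have fga : f * g * a = x * (x * k) by rewrite -gh mulgCA -fa; comm_mul.
have Jxk : J (x * k).
  apply: (radicalX (n := 1)) => //; rewrite expg2.
  have -> : x * k * (x * k) = a * (f * g * k).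
    transitivity (x * (x * k) * k); first by comm_mul.
    by rewrite -fga; comm_mul.
  exact: ideal_mulr.
have [c sxk] := aJ _ Jxk.
have nNfgs : ~ N (f * g * s) := mN.2 _ _ (mN.2 _ _ nNf nNg) nNs.
case: nNfgs.
suff -> : f * g * s = x * c by apply: ideal_mulr.
apply: (canc_inj na); transitivity (x * (s * (x * k))); last first.
  by rewrite sxk; comm_mul.
transitivity (f * g * a * s); first by comm_mul.
by rewrite fga; comm_mul.
Qed.

(** Every nonzero principal ideal is a product of radical factors, each of which
    contains an element of value at most one. *)
Lemma discrete_of_generates N x : SP_monoid q -> prime_ideal N ->
  ~ zeros H x -> generates N x -> discrete_at N.
Proof.
move=> /SP_monoidP SP pN nx gx; exists x; split=> // b nb.
have mN := prime_mul_closed pN; have [qN nN1 prN] := pN.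
have [K fK bK] := SP _ (ideal_multiples b).
suff [k Kk [n [f nNf kx]]] : exists2 k, K k &
    exists n, exists2 f, ~ N f & multiples k (f * x ^+ n).
  exists n, f => //; apply: multiples_trans kx.
  by rewrite bK; apply: sub_cl.
have : exists L, q (set_mul K L) = multiples b.
  by exists [set 1]; rewrite set_mul1.
elim: fK {bK} => {K} [_|J K qJ rJ _ IHK [L JKLb]].
  by exists 1 => //; exists 0%N, 1 => //; rewrite mulg1; apply: multiples_refl.
have [k Kk [n [g nNg kx]]] : exists2 k, K k &
    exists n, exists2 f, ~ N f & multiples k (f * x ^+ n).
  by apply: IHK; exists (set_mul J L); rewrite set_mulA (set_mulC K).
have [a Ja [m [f nNf ax]]] : exists2 a, J a &
    exists m, exists2 f, ~ N f & multiples a (f * x ^+ m).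
  case: (pselect (J `<=` N)) => [JN|].
    have JKLb' : q (set_mul J (set_mul K L)) = multiples b by rewrite set_mulA.
    have [a Ja [f nNf ax]] := radical_factor_value pN nb gx qJ rJ JKLb' JN.
    by exists a => //; exists 1%N, f.
  move=> /existsNP[a /not_implyP[Ja nNa]]; exists a => //.
  by exists 0%N, a => //; apply: multiplesM.
exists (a * k); first exact: set_mulP.
exists (m + n)%N, (f * g); first exact: mN.2.
rewrite expgnDr; have [u au] := ax; have [v kv] := kx.
exists (u * v); transitivity (f * x ^+ m * (g * x ^+ n)); first by comm_mul.
by rewrite au kv; comm_mul.
Qed.

Lemma factored_radical_at M K L x : prime_ideal M -> ~ zeros H x ->
  q (set_mul K L) = multiples x -> factored K -> K `<=` M ->
  exists J, [/\ q_ideal q J, radical_set J, K `<=` J, J `<=` M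
    & invertible_at M J].
Proof.
move=> pM nx + fK; have [qM nM1 prM] := pM.
elim: fK L => {K} [L _ /(_ 1 erefl)//|J K qJ rJ _ IHK] L JKL JKM.
case: (pselect (J `<=` M)) => [JM|/existsNP[j /not_implyP[Jj nMj]]].
  exists J; split=> //; first exact: set_mul_subl.
  by apply: (invertible_factor (L := set_mul K L) (b := x)) => //;
    rewrite set_mulA.
have KM : K `<=` M.
  by move=> k Kk; have [|//|//] := prM j k; apply: JKM; apply: set_mulP.
have [||J' [qJ' rJ' KJ' J'M iJ']] := IHK (set_mul J L) => //.
  by rewrite set_mulA (set_mulC K).
exists J'; split=> // _ [j' _ [k Kk <-]]; apply: ideal_mull => //; exact: KJ'.
Qed.

(** A product of ideals that lies in the prime [N] but not in [N^2] has just one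
    factor in [N], and is locally equal to that factor. *)
Lemma factored_not_square N K : prime_ideal N -> factored K -> K `<=` N ->
  ~ (K `<=` q (set_mul N N)) ->
  exists J, [/\ q_ideal q J, radical_set J, K `<=` J & exists2 f, ~ N f
    & forall y, J y -> q K (f * y)].
Proof.
move=> pN fK; have [qN nN1 prN] := pN; have mN := prime_mul_closed pN.
elim: fK => {K} [/(_ 1 erefl)//|J K qJ rJ _ IHK] JKN nJK.
case: (pselect (J `<=` N)) => [JN|/existsNP[j /not_implyP[Jj nNj]]].
  have [k [Kk nNk]] : exists k, K k /\ ~ N k.
    apply: contrapT => nk; apply: nJK => _ [j Jj [k Kk <-]].
    apply: sub_cl; apply: set_mulP; first exact: JN.
    by apply: contrapT => nNk; apply: nk; exists k.
  exists J; split=> //; first exact: set_mul_subl.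
  exists k => // y Jy; rewrite mulC_canc; apply: sub_cl; exact: set_mulP.
have KN : K `<=` N.
  by move=> k Kk; have [|//|//] := prN j k; apply: JKN; apply: set_mulP.
have [//||J' [qJ' rJ' KJ' [f nNf fJ']]] := IHK.
  move=> KNN; apply: nJK => _ [j' _ [k Kk <-]].
  by apply: ideal_mull; [apply: cl_idem | apply: KNN].
exists J'; split=> //.
  by move=> _ [j' _ [k Kk <-]]; apply: ideal_mull => //; apply: KJ'.
exists (j * f); first exact: mN.2.
move=> y /fJ' Kfy; rewrite -mulgA; have := cl_scaled j Kfy; apply: cl_mono.
by move=> _ [k Kk <-]; apply: set_mulP.
Qed.

(** When [N] is minimal over the product, each radical factor is locally [N] or
    everything, so the product is locally a power of [N]; all powers of an
    idempotent [N] agree. *)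
Lemma factored_idempotent N K : prime_ideal N -> N `<=` q (set_mul N N) ->
  factored K -> (forall z, N z -> exists f n, ~ N f /\ q K (f * z ^+ n)) ->
  N `<=` local_part (~` N) (q K).
Proof.
move=> pN NN; have [qN nN1 prN] := pN; have mN := prime_mul_closed pN.
elim=> {K} [_ z _|J K qJ rJ _ IHK hJK]; first by exists 1; rewrite ?cl1.
have JKJ : q (set_mul J K) `<=` J by apply: cl_min => //; apply: set_mul_subl.
have JKK : q (set_mul J K) `<=` q K.
  apply: cl_min; first exact: cl_idem.
  by move=> _ [j _ [k Kk <-]]; apply: ideal_mull;
    [apply: cl_idem | apply: sub_cl].
have NJ : N `<=` local_part (~` N) J.
  move=> z /hJK[f [n [nNf /JKJ Jfz]]]; exists f => //.
  apply: (radicalX (n := n)) => //; rewrite expgMn_canc expgS expgSr.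
  have -> : f * f ^+ n * (z ^+ n * z) = f * z ^+ n * (f ^+ n * z) by comm_mul.
  exact: ideal_mulr.
have NK : N `<=` local_part (~` N) (q K).
  by apply: IHK => z /hJK[f [n [nNf /JKK Kfz]]]; exists f, n.
apply: subset_trans NN _; apply: cl_min.
  by apply: ideal_local_part => //; apply: cl_idem.
move=> _ [x /NJ[f nNf Jfx] [y /NK[g nNg Kgy] <-]].
exists (f * g); first exact: mN.2.
suff -> : f * g * (x * y) = f * x * (g * y).
  by rewrite -cl_set_mulr; apply: sub_cl; apply: set_mulP.
by comm_mul.
Qed.

(** Take [x] in [N] outside the square of [N].  For [y] in [N], the ideal of [x]
    and [y^2] is locally radical and hence contains [y] locally; intersecting
    with [y H], the modular law puts some [f] outside [N] into the ideal of [y]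
    and [(x H : y)], so the latter is not contained in [N]. *)
Lemma generates_of_not_square N : modular q -> SP_monoid q -> prime_ideal N ->
  ~ (N `<=` q (set_mul N N)) -> exists2 x, ~ zeros H x & generates N x.
Proof.
move=> modq /SP_monoidP SP pN /existsNP[x /not_implyP[Nx nNx]].
have [qN nN1 prN] := pN; have mN := prime_mul_closed pN.
exists x; first by move=> zx; apply: nNx; apply: zeros_sub_cl.
split=> // y Ny.
case: (pselect (zeros H y)) => [zy|ny].
  by exists 1 => //; rewrite mul1g; apply: multiples_zero.
have [K fK AK] := SP _ (cl_idem (multiples (y * y) `|` multiples x)).
have KA : K `<=` q (multiples (y * y) `|` multiples x) by rewrite AK;
  apply: sub_cl.
have AN : q (multiples (y * y) `|` multiples x) `<=` N.
  by apply: cl_min => // z [] [u ->]; rewrite -?mulgA; apply: ideal_mulr.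
have [|J [qJ rJ KJ [f nNf fJ]]] :=
  factored_not_square pN fK (subset_trans KA AN).
  move=> KNN; apply: nNx; move: (cl_min (@cl_idem _) KNN); rewrite -AK; apply.
  by apply: sub_cl; right; apply: multiples_refl.
have Jy : J y.
  apply: (radicalX (n := 1)) => //; rewrite expg2.
  have : q K (y * y) by rewrite -AK; apply: sub_cl; left; apply: multiples_refl.
  by apply: cl_min.
have y2y : multiples (y * y) `<=` multiples y.
  by apply: ideal_multiples_sub; [apply: ideal_multiples | apply: multiplesM].
have fyA0 : (q (multiples (y * y) `|` multiples x) `&` multiples y) (f * y).
  by split; [rewrite AK; apply: fJ | apply: multiples_mull;
    apply: multiples_refl].
have fyA := modq _ _ _ (ideal_multiples _) (ideal_multiples _) (ideal_multiples _)
  y2y _ fyA0.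
have : q (mul y @` (multiples y `|` [set l | multiples x (y * l)])) (y * f).
  rewrite mulC_canc; move: fyA; apply: cl_mono => z [[u ->]|[xz [u yz]]].
    by exists (y * u); [left; exists u | rewrite mulgA].
  by exists u => //; right; rewrite /= -yz.
rewrite -cl_scale => -[f' yf' /(canc_inj ny) ff'].
apply: contrapT => ndvd; apply: nNf; rewrite -ff'; move: yf';
  apply: cl_min => // l.
case=> [[u ->]|xyl]; first exact: ideal_mulr.
by apply: contrapT => nNl; apply: ndvd; exists l => //; rewrite mulC_canc.
Qed.

(** If [N] were its own square, then [y] would lie locally in the ideal of [P]
    and [y^2], over which [N] is minimal as well.  Intersecting with [y H], where
    [P] meets it in [y P], the modular law would put some [f] outside [N] into
    the ideal of [y] and [P], which is contained in [N]. *)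
Lemma minimal_not_square P N y : modular q -> SP_monoid q ->
  q_ideal q P -> (forall a b, P (a * b) -> P a \/ P b) -> ~ P y ->
  prime_ideal N -> minimal_over N (q (P `|` [set y])) ->
  ~ (N `<=` q (set_mul N N)).
Proof.
move=> modq /SP_monoidP SP qP prP nPy pN [AN minN] NN.
have [qN nN1 prN] := pN; have mN := prime_mul_closed pN.
have ny : ~ zeros H y by move=> /(ideal_zeros qP).
have PN : P `<=` N by move=> p Pp; apply: AN; apply: sub_cl; left.
have Ny : N y by apply: AN; apply: sub_cl; right.
set B := q (multiples (y * y) `|` P).
have [K fK BK] := SP _ (cl_idem (multiples (y * y) `|` P)).
have [f nNf Bfy] : local_part (~` N) (q K) y.
  apply: factored_idempotent => // z /minN[f [n [nNf Afz]]]; rewrite -BK -/B.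
  exists (f * f), (n + n)%N; split; first exact: mN.2.
  have -> : f * f * z ^+ (n + n) = f * z ^+ n * (f * z ^+ n).
    by rewrite expgnDr; comm_mul.
  have qB : q_ideal q B by apply: cl_idem.
  have BP p : P p -> B p by move=> Pp; apply: sub_cl; right.
  have {}Afz u : B (y * u) -> colon B [set u] (f * z ^+ n).
    move=> Byu; move: Afz; apply: cl_min; first exact: ideal_colon.
    by move=> w [Pw|->] _ -> //; apply: ideal_mulr => //; apply: BP.
  have By2 : B (y * y) by apply: sub_cl; left; apply: multiples_refl.
  apply: (Afz _ _ _ erefl); rewrite mulC_canc; apply: (Afz y) => //.
have y2y : multiples (y * y) `<=` multiples y.
  by apply: ideal_multiples_sub; [apply: ideal_multiples | apply: multiplesM].
have fyA0 : (B `&` multiples y) (f * y).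
  by split; [rewrite /B BK | apply: multiples_mull; apply: multiples_refl].
have fyA := modq _ _ _ (ideal_multiples _) qP (ideal_multiples _) y2y _ fyA0.
have : q (mul y @` (multiples y `|` P)) (y * f).
  rewrite mulC_canc; move: fyA; apply: cl_mono => z [[u ->]|[Pz [u yz]]].
    by exists (y * u); [left; exists u | rewrite mulgA].
  by exists u => //; right; move: Pz; rewrite yz => /prP[].
rewrite -cl_scale => -[f' yf' /(canc_inj ny) ff'].
apply: nNf; rewrite -ff'; move: yf'; apply: cl_min => // l [[u ->]|/PN//].
exact: ideal_mulr.
Qed.

(** A nonzero prime inside [N] contains a power of the uniformizer. *)
Lemma discrete_prime_minimal N P : prime_ideal P -> discrete_at N ->
  P `<=` N -> ~ (P `<=` zeros H) -> N `<=` P.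
Proof.
move=> [qP nP1 prP] [x [nx [Nx gx] dx]] PN /existsNP[p /not_implyP[Pp np]] y Ny.
have [n [f nNf px]] := dx p np.
have [//||Px] := prP f (x ^+ n); first exact: (ideal_multiples_sub qP Pp).
  by move=> /PN.
have {Px}Px : P x by apply: primeX Px.
have [g nNg xy] := gx y Ny.
by have [|/PN|] := prP g y; first exact: (ideal_multiples_sub qP Px).
Qed.

(** Take a prime [P] in [M] minimal over a nonzero [x]; it is a discrete
    valuation.  If [P] were not [M], a prime [N] in [M] minimal over [P] and a
    further element of [M] would be a discrete valuation too, but the only
    nonzero prime inside a discrete valuation is itself. *)
Lemma SP_discrete_at M : modular q -> SP_monoid q -> q_ideal q (zeros H) ->
  prime_ideal M -> ~ (M `<=` zeros H) -> discrete_at M.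
Proof.
move=> modq SP qz pM /existsNP[x /not_implyP[Mx nx]].
have [qM nM1 prM] := pM.
have step Q y : q_ideal q Q -> (forall a b, Q (a * b) -> Q a \/ Q b) ->
    Q `<=` M -> M y -> ~ Q y ->
    exists N, [/\ prime_ideal N, N `<=` M, Q `<=` N, N y & discrete_at N].
  move=> qQ prQ QM My nQy.
  have [|N [pN NM minN]] := minimal_prime_exists (cl_idem (Q `|` [set y])) pM.
    by apply: cl_min => // z [/QM|->].
  have [] := generates_of_not_square modq SP pN.
    exact: (minimal_not_square modq SP qQ prQ nQy pN minN).
  move=> u nu gu; exists N; split=> //;
    last exact: (discrete_of_generates SP pN nu).
    by move=> z Qz; apply: minN.1; apply: sub_cl; left.
  by apply: minN.1; apply: sub_cl; right.
have prz (a b : H) : zeros H (a * b) -> zeros H a \/ zeros H b.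
  exact: zeros_mul.
have [P [pP PM _ Px dP]] := step _ x qz prz (ideal_zeros qM) Mx nx.
suff -> : M = P by [].
apply/seteqP; split=> // y My; apply: contrapT => nPy.
have [qP _ prP] := pP.
have [N [pN _ PN Ny dN]] := step P y qP prP PM My nPy.
apply: nPy; apply: (discrete_prime_minimal pP dN) => //.
by move=> /(_ x Px)/nx.
Qed.

End IdealSystemTheory.

(** * Fractions, the t-system and the modularization *)

Section Fractions.
Variables (H : cancMonoidType) (S : mulset H).
Implicit Types x y s t : H.

Lemma loc_frac_ind (P : localization S -> Prop) :
  (forall x s (hs : mulset_car S s), P (loc_frac x hs)) -> forall g, P g.
Proof.
move=> Pf; elim/loc_ind=> u.
suff -> : u = frac u.1 (denP u) by apply: Pf.
by case: u => x s; congr pair; apply: val_inj.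
Qed.

Lemma loc_fracE x s (hs : mulset_car S s) y t (ht : mulset_car S t) :
  loc_frac x hs = loc_frac y ht <-> x * t = y * s.
Proof. by split=> [/fracE|h]; last apply/fracE. Qed.

Lemma loc_fracM x s (hs : mulset_car S s) y t (ht : mulset_car S t) :
  (loc_frac x hs * loc_frac y ht :
    localization S) = loc_frac (x * y) (mulsetM hs ht).
Proof. by rewrite -[LHS]/(loc_mul _ _) loc_mulE; apply/fracE. Qed.

End Fractions.

Section DivisorialSystem.
Variable H : cancMonoidType.
Implicit Types (a c g h x y z : H) (X Y E I M : set H).

Notation ratio g nh := (@loc_frac H (nonzero_mulset H) g _ nh).

Lemma range_ratio g h (nh : ~ zeros H h) x :
  range (@quot_embed H) ((ratio g nh : quot H) * quot_embed x) <->
    multiples h (g * x).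
Proof.
rewrite loc_fracM; split=> [[u _ /loc_fracE]|[u gx]].
  by rewrite !mulg1 => <-; exists u; apply: mulC_canc.
by exists u => //; apply/loc_fracE; rewrite !mulg1 gx mulC_canc.
Qed.

Lemma frac_inv_ratio X g h (nh : ~ zeros H h) :
  frac_inv (@quot_embed H @` X) (ratio g nh) <->
  forall x, X x -> multiples h (g * x).
Proof.
split=> [gX x Xx|gX _ [_ [x Xx <-] <-]]; last by apply/range_ratio; apply: gX.
by apply/(range_ratio _ nh); apply: gX; exists (quot_embed x) => //; exists x.
Qed.

(** The divisorial closure in terms of divisibility in [H], writing the elements
    of the quotient monoid as fractions [g / h]. *)
Lemma v_systemP E x : v_system E x <->
  forall g h, ~ zeros H h -> (forall e, E e -> multiples h (g * e)) ->
    multiples h (g * x).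
Proof.
split=> [vx g h nh gE|vx].
  apply/(range_ratio _ nh); rewrite mulC_canc; apply: vx.
  by exists (ratio g nh) => //; apply/frac_inv_ratio.
move=> _ [w + <-]; elim/loc_frac_ind: w => g h nh /frac_inv_ratio gE.
by rewrite mulC_canc; apply/range_ratio; apply: vx.
Qed.

Lemma v_mono E E' : E `<=` E' -> v_system E `<=` v_system E'.
Proof.
by move=> EE' x /v_systemP vx; apply/v_systemP => g h nh gE;
  apply: vx => // e /EE'; apply: gE.
Qed.

Lemma v_scale c E x : v_system E x -> v_system (mul c @` E) (c * x).
Proof.
move=> /v_systemP vx; apply/v_systemP => g h nh gE; rewrite mulgA.
by apply: vx => // e Ee; rewrite -mulgA; apply: gE; exists e.
Qed.

Lemma v_unscale c E y : ~ zeros H c -> v_system (mul c @` E) y ->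
  exists2 x, v_system E x & y = c * x.
Proof.
move=> nc /v_systemP vy.
have [|x cx] := vy 1 c nc; first by move=> _ [e _ <-]; rewrite mul1g;
  apply: multiplesM.
move: cx; rewrite mul1g => cx; exists x => //; apply/v_systemP => g h nh gE.
apply: (multiples_cancel nc); rewrite mulgCA -cx; apply: vy => [|_ [e Ee <-]].
  by apply: nonzeroM.
by rewrite mulgCA; apply: multiples_scale; apply: gE.
Qed.

Hypothesis hHG : ~ eq_quot_monoid H.

Lemma nonunit_exists : exists2 u, ~ zeros H u & ~ multiples u 1.
Proof.
apply: contrapT => nu; apply: hHG; apply/seteqP; split=> // w _.
elim/loc_frac_ind: w => x s ns.
have [t st] : multiples s 1 by apply: contrapT => n1; apply: nu; exists s.
by exists (x * t) => //; apply/loc_fracE;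
  rewrite mulg1 -mulgA [t * s]mulC_canc -st mulg1.
Qed.

(** The closure of the zero set is stable under multiplication and division by
    every element, so a nonzero member would make all nonzero elements
    invertible. *)
Lemma ideal_zeros_set (q : ideal_system H) : q_ideal q (zeros H).
Proof.
have cz c : mul c @` zeros H = zeros H.
  apply/seteqP; split=> z; first by move=> [y zy <-]; apply: zerosM_r.
  by move=> zz; exists z => //; rewrite mulC_canc zz.
apply: q_idealI => x qx; apply: contrapT => nx.
have [u nu n1] := nonunit_exists; apply: n1.
have : (mul (x * u) @` q (zeros H)) x by rewrite cl_scale cz.
move=> [y _]; rewrite -{2}(mulg1 x) -!mulgA => /(canc_inj nx) <-.
exact: multiplesM.
Qed.

Lemma v_zeros : v_system (zeros H) `<=` zeros H.
Proof.
move=> x /v_systemP vx; apply: contrapT => nx.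
have [u nu n1] := nonunit_exists; apply: n1.
have [||y] := vx 1 (x * u); first exact: nonzeroM.
  by move=> z zz; apply: multiples_zero; apply: zerosM_r.
rewrite mul1g -{1}(mulg1 x) -mulgA => /(canc_inj nx) ->; exact: multiplesM.
Qed.

Lemma v_multiples E a : E `<=` multiples a -> v_system E `<=` multiples a.
Proof.
move=> Ea; case: (pselect (zeros H a)) => [za|na].
  by move: Ea; rewrite multiples_of_zero // => /v_mono Ez x /Ez; apply: v_zeros.
move=> x /v_systemP/(_ 1 a na); rewrite mul1g; apply => e /Ea.
by rewrite mul1g.
Qed.

Lemma t_finite E x : finite_set E -> v_system E x -> t_system H E x.
Proof. by move=> finE vx; exists E; first split. Qed.

Fact t_sub X : set_mul X setT `|` zeros H `<=` t_system H X.
Proof.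
move=> x [[y Xy [u _ <-]]|zx].
  exists [set y]; first by split=> [_ ->|] //; apply: finite_set1.
  by apply/v_systemP => g h nh gX; rewrite mulgA; apply: multiples_mulr;
    apply: gX.
exists set0; first by split=> //; apply: finite_set0.
by apply/v_systemP => g h nh _; apply: multiples_zero; apply: zerosM_r.
Qed.

Fact t_closed X Y : X `<=` t_system H Y -> t_system H X `<=` t_system H Y.
Proof.
move=> XY x [E [EX finE] vx].
have [F YF EF] := finite_directed (finite_subsets0 Y)
  (finite_subsets_directed v_mono) finE (subset_trans EX XY).
exists F => //; apply/v_systemP => g h nh gF.
by move/v_systemP: vx; apply => // e /EF/v_systemP; apply.
Qed.

Fact t_scale c X : mul c @` t_system H X = t_system H (mul c @` X).
Proof.
apply/seteqP; split=> y.
  move=> [x [E [EX finE] vx] <-]; exists (mul c @` E); last exact: v_scale.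
  by split; [move=> _ [e /EX Xe <-]; exists e | apply: finite_image].
move=> [E [EX finE] vy].
case: (pselect (zeros H c)) => [zc|nc].
  exists c; first by apply: t_sub; right.
  suff zy : zeros H y by rewrite zc -(zy c) mulC_canc zc.
  apply: v_zeros; apply: v_mono vy => e /EX[x _ <-]; exact: zerosM_l.
pose F := [set x | E (c * x) /\ X x].
have EF : E = mul c @` F.
  apply/seteqP; split=> [e Ee|_ [x [Ex _] <-]//].
  by have [x Xx cx] := EX e Ee; exists x => //; split=> //; rewrite cx.
have [x vx ->] : exists2 x, v_system F x & y = c * x by apply: v_unscale;
  rewrite -?EF.
exists x => //; exists F => //; split=> [z []//|].
apply: (sub_finite_set (B := mul c @^-1` E)) => [z []//|].
by apply: finite_preimage => // u v _ _; apply: canc_inj.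
Qed.

Fact t_finitary X :
  t_system H X = \bigcup_(E in [set E | E `<=` X /\ finite_set E]) t_system H E.
Proof.
apply/seteqP; split=> x [E [EX finE] vx].
  by exists E => //; apply: t_finite.
by apply: (t_closed (X := E)) => // e /EX Xe; apply: t_sub; left;
  exists e => //; exists 1; rewrite // mulg1.
Qed.

Definition t_ideal_system : ideal_system H :=
  IdealSystem t_sub t_closed t_scale t_finitary.

(** The t-system is the largest finitary ideal system. *)
Lemma le_t (q : ideal_system H) : le_system q (t_system H).
Proof.
move=> X x /cl_fin[E [finE EX qx]]; exists E => //.
apply/v_systemP => g h nh gE; have := cl_scaled g qx; apply: cl_min.
  exact: ideal_multiples.
by move=> _ [e Ee <-]; apply: gE.
Qed.

End DivisorialSystem.

Section Modularization.
Variables (H : cancMonoidType) (p r : ideal_system H).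
Implicit Types (c f x y z : H) (E F I J M N X Y : set H).
Hypothesis p_le_r : le_system p r.

(** The sets [F] generating [H] are those contained in no maximal ideal, so the
    modularization is the intersection of the localizations of the
    p-closure. *)
Lemma modularizationP X x :
  modularization p r X x <->
  forall M, q_max r M -> local_part (~` M) (p X) x.
Proof.
split=> [[F [xF rF]] M MM|loc].
  have [rM nM1 _] := q_maxP MM; apply: contrapT => nloc.
  have FM : F `<=` M.
    move=> f Ff; apply: contrapT => nMf; apply: nloc; exists f => //.
    by rewrite mulC_canc; apply: xF; exists f.
  by apply: nM1; move: (cl_min rM FM); rewrite rF; apply.
exists [set f | p X (f * x)]; split.
  by move=> _ [f pf <-]; rewrite mulC_canc.
apply: cl_one; apply: ideal_top; first exact: cl_idem.
by move=> M /loc[f nMf pf]; exists f => //; apply: sub_cl.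
Qed.

Lemma sub_modularization X : p X `<=` modularization p r X.
Proof.
move=> x px; apply/modularizationP => M /q_maxP[rM nM1 _].
by exists 1 => //; rewrite mul1g.
Qed.

Fact mod_sub X : set_mul X setT `|` zeros H `<=` modularization p r X.
Proof. by move=> x Xx; apply: sub_modularization; apply: cl_sub. Qed.

Fact mod_closed X Y : X `<=` modularization p r Y ->
  modularization p r X `<=` modularization p r Y.
Proof.
move=> XY x /modularizationP mx; apply/modularizationP => M MM.
have mM := prime_mul_closed (q_maxP MM).
have pY := ideal_local_part mM (cl_idem p Y).
have [f nMf pfx] := mx M MM.
have [g nMg pgx] : local_part (~` M) (p Y) (f * x).
  by move: pfx; apply: cl_min => // z /XY/modularizationP; apply.
by exists (g * f); [apply: mM.2 | rewrite -mulgA].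
Qed.

Fact mod_scale c X :
  mul c @` modularization p r X = modularization p r (mul c @` X).
Proof.
apply/seteqP; split=> y.
  move=> [x /modularizationP mx <-]; apply/modularizationP => M /mx[f nMf pfx].
  by exists f => //; rewrite mulgCA; apply: cl_scaled.
move=> [F [yF rF]].
have [x yx] : multiples c y.
  have : r (mul y @` F) y.
    by rewrite -cl_scale rF; exists 1 => //; rewrite mulg1.
  apply: cl_min; first exact: ideal_multiples.
  by move=> w /yF; rewrite -cl_scale => -[u _ <-]; apply: multiplesM.
case: (pselect (zeros H c)) => [zc|nc].
  by exists c; [apply: mod_sub; right | rewrite yx !zc].
exists x => //; exists F; split=> // _ [f Ff <-].
have : p (mul c @` X) (y * f) by apply: yF; exists f.
by rewrite -cl_scale yx -mulgA => -[u pu /(canc_inj nc) <-].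
Qed.

Fact mod_finitary X : modularization p r X =
  \bigcup_(E in [set E | E `<=` X /\ finite_set E]) modularization p r E.
Proof.
apply/seteqP; split=> x; last first.
  move=> [E [EX _]]; apply: mod_closed => e /EX Xe.
  by apply: sub_modularization; apply: sub_cl.
move=> [F [xF rF]].
have [|D [finD DF rD]] := @cl_fin _ r F 1; first by rewrite rF.
have [||E EX xDE] := finite_directed (finite_subsets0 X)
    (finite_subsets_directed (cl_mono (q := p))) (E := mul x @` D).
- exact: finite_image.
- by move=> _ [d /DF Fd <-]; rewrite -cl_finitary; apply: xF; exists d.
by exists E => //; exists D; split=> //; apply: cl_one.
Qed.

Definition modularization_system : ideal_system H :=
  IdealSystem mod_sub mod_closed mod_scale mod_finitary.

Notation m := modularization_system.

Lemma le_modularization : le_system m r.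
Proof.
move=> X x [F [xF rF]]; have : r (mul x @` F) x.
  by rewrite -cl_scale rF; exists 1 => //; rewrite mulg1.
by apply: cl_min; [apply: cl_idem | move=> w /xF; apply: p_le_r].
Qed.

Lemma ideal_of_modularization I : q_ideal m I -> q_ideal p I.
Proof.
by move=> mI; apply: q_idealI => x /sub_modularization;
  rewrite -[in X in _ -> X]mI.
Qed.

Lemma ideal_modularization I : q_ideal r I -> q_ideal m I.
Proof.
by move=> rI; apply: q_idealI => x /le_modularization; rewrite rI.
Qed.

Lemma modularization_local I x : q_ideal m I ->
  (forall M, q_max r M -> local_part (~` M) I x) -> I x.
Proof.
move=> mI loc; rewrite -mI; apply/modularizationP => M /loc[f nMf If].
by exists f => //; apply: sub_cl.
Qed.

(** A proper ideal of the modularization generates a proper r-ideal, so both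
    systems have the same maximal ideals. *)
Lemma modularization_max : q_max m = q_max r.
Proof.
have top N : q_ideal m N -> ~ N 1 -> ~ r N 1.
  move=> mN nN1 rN1; apply: nN1; rewrite -mN; exists N; split.
    by move=> _ [x Nx <-]; rewrite mul1g; apply: sub_cl.
  exact: cl_one.
apply/seteqP; split=> M MM.
  have [mM nM maxM] := MM; have [_ nM1 _] := q_maxP MM.
  have MrM : r M = M.
    apply: maxM; [|move=> rM; apply: (top M mM nM1);
      rewrite rM|exact: sub_cl] => //.
    by apply: ideal_modularization; apply: cl_idem.
  split=> // J rJ pJ MJ; apply: maxM => //; exact: ideal_modularization.
have [rM nM maxM] := MM.
split=> //; first exact: ideal_modularization.
move=> J mJ pJ MJ; apply/seteqP; split=> //.
have nJ1 : ~ J 1 by move=> J1; apply: pJ; apply: (ideal1 mJ).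
suff <- : r J = M by apply: sub_cl.
apply: maxM; first exact: cl_idem.
  by move=> rJ; apply: (top J mJ nJ1); rewrite rJ.
by move=> x /MJ; apply: sub_cl.
Qed.

Lemma modular_modularization : modular p -> modular m.
Proof.
move=> modp I J N mI mJ mN IN x [/modularizationP mx Nx].
apply/modularizationP => M /mx[f nMf pfx]; exists f => //.
apply: (modp I J N) => //; try exact: ideal_of_modularization.
by split=> //; apply: (ideal_mull _ mN Nx).
Qed.

End Modularization.

(** * Discrete valuations at a prime *)

Section DiscreteLocalization.
Variables (H : cancMonoidType) (M : set H) (hM : prime_s_ideal M).
Implicit Types (b c f s t x y : H).
Notation L := (localization_at hM).
Notation S := (compl_mulset hM).
Let num x : L := @loc_embed _ S x.

Let mM : mul_closed (~` M).
Proof. by split; [apply: prime_compl1 | apply: prime_complM]. Qed.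

Let Mmul x y : M x -> M (x * y).
Proof. by case: hM => sM _ _; apply: s_ideal_mul. Qed.

Lemma zeros_loc_frac x s (hs : mulset_car S s) :
  zeros L (loc_frac x hs) <-> zeros H x.
Proof.
split=> [zxs|zx]; last first.
  by elim/loc_frac_ind=> y t ht; rewrite loc_fracM; apply/loc_fracE;
    rewrite -mulgA !zx.
apply: contrapT => nx; have [y [z]] := @canc_nontrivial H; apply.
suff one (w : H) : w = 1 by rewrite (one y) (one z).
have := zxs (num w); rewrite loc_fracM => /loc_fracE.
rewrite mulg1 -mulgA => /(canc_inj nx); rewrite mulC_canc -{2}(mulg1 s).
by apply: canc_inj; apply: (mulset_nz (m := S)).
Qed.

Lemma multiples_loc_frac x s (hs : mulset_car S s) y t (ht : mulset_car S t) :
  multiples (loc_frac x hs : L) (loc_frac y ht) <->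
  exists2 f, ~ M f & multiples x (f * y).
Proof.
split=> [[w]|[f nMf [w fy]]].
  elim/loc_frac_ind: w => z u hu; rewrite loc_fracM => /loc_fracE eq.
  exists (s * u); first exact: mM.2.
  by rewrite mulC_canc eq -mulgA; apply: multiplesM.
have hft : mulset_car S (f * t) by apply: mM.2.
exists (loc_frac (w * s) hft); rewrite loc_fracM; apply/loc_fracE.
transitivity (f * y * (s * t)); first by comm_mul.
by rewrite fy; comm_mul.
Qed.

(** Dividing [b] by [x] as long as possible: either [n] divisions succeed, or the
    process stops at a local unit. *)
Lemma generator_valuation x b n : generates M x ->
  (exists2 f, ~ M f & multiples (x ^+ n) (f * b)) \/
  (exists2 k, (k < n)%N & exists2 f, ~ M f & multiples b (f * x ^+ k)).
Proof.
move=> [Mx gx]; elim: n => [|n [[f nMf [c fb]]|[k kn ?]]].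
- by left; exists 1; [apply: mM.1 | exists b; rewrite expg0 !mul1g].
- case: (pselect (M c)) => [/gx[g nMg [d gc]]|nMc]; last first.
    by right; exists n => //; exists c => //; exists f;
      rewrite mulC_canc -fb mulC_canc.
  left; exists (g * f); first exact: mM.2.
  by exists d; rewrite -mulgA fb mulgCA gc expgSr -mulgA.
- by right; exists k => //; apply: ltnW.
Qed.

(** The localization of [M] is principal, say generated by [x].  The elements
    divisible by all powers of [x] form an s-ideal which is [x] times itself;
    being principal, it is zero. *)
Lemma discrete_of_DVM : ~ (M `<=` zeros H) -> DVM L -> discrete_at M.
Proof.
move=> /existsNP[m /not_implyP[Mm nm]] [_ principalL].
pose XM := [set w : L | exists x s (hs : mulset_car S s), M x /\
  w = loc_frac x hs].
have sXM : s_ideal XM.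
  apply/seteqP; split=> w.
    by move=> Xw; left; exists w => //; exists 1 => //; rewrite mulg1.
  case=> [[_ [x [s [hs [Mx ->]]]] [u _ <-]]|].
    elim/loc_frac_ind: u => y t ht; rewrite loc_fracM; do 3!eexists; split;
      last by [].
    exact: Mmul.
  elim/loc_frac_ind: w => x s hs /zeros_loc_frac zx; exists x, s, hs;
    split=> //.
  by case: hM => -> _ _; right.
have [XMz|] := (principalP _).1 (principalL _ sXM).
  have : XM (num m) by do 3!eexists; split; last by [].
  by rewrite XMz => /zeros_loc_frac/nm.
move=> [w + XMw]; elim/loc_frac_ind: w XMw => x s hs XMx nx'.
have nx : ~ zeros H x by move=> zx; apply: nx'; apply/zeros_loc_frac.
have gx : generates M x.
  split.
    have [y [t [ht [My /loc_fracE xt]]]] : XM (loc_frac x hs).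
      by rewrite XMx; apply: multiples_refl.
    have [_ _ prM] := hM; have [|//|//] := prM x t.
    by rewrite xt; apply: Mmul.
  move=> y My; apply/(multiples_loc_frac x hs y (mulset1 S)); rewrite -XMx.
  by do 3!eexists; split; last by [].
exists x; split=> // b nb; apply: contrapT => nbx.
have ldb n : exists2 f, ~ M f & multiples (x ^+ n) (f * b).
  by case: (generator_valuation b n gx) => // -[k _ ?]; case: nbx; exists k.
pose Y := [set w : L | forall n, multiples (num (x ^+ n)) w].
have sY : s_ideal Y.
  apply/seteqP; split=> w.
    by move=> Yw; left; exists w => //; exists 1 => //; rewrite mulg1.
  by case=> [[v Yv [u _ <-]] n|zw n];
    [apply: multiples_mulr | apply: multiples_zero].
have [YZ|] := (principalP _).1 (principalL _ sY).
  apply: nb; apply/(zeros_loc_frac _ (mulset1 S)); rewrite -YZ => n.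
  by apply/multiples_loc_frac; apply: ldb.
move=> [w + Yw]; elim/loc_frac_ind: w Yw => y t ht Yy ny'.
have ny : ~ zeros H y by move=> zy; apply: ny'; apply/zeros_loc_frac.
have ldy n : exists2 f, ~ M f & multiples (x ^+ n) (f * y).
  apply/(multiples_loc_frac _ (mulset1 S) _ ht).
  have : Y (loc_frac y ht) by rewrite Yy; apply: multiples_refl.
  exact.
have [f nMf [y' fy]] := ldy 1%N; rewrite expg1 in fy.
have : Y (num y').
  move=> n; apply/multiples_loc_frac; have [g nMg [v gy]] := ldy n.+1.
  exists g => //; exists (f * v); apply: (canc_inj nx).
  transitivity (g * (x * y')); first by comm_mul.
  by rewrite -fy mulgCA gy expgS; comm_mul.
rewrite Yy => /multiples_loc_frac[g nMg [c gy']].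
have : ~ M (f * g) by apply: mM.2.
apply; suff -> : f * g = x * c by apply: Mmul; case: gx.
apply: (canc_inj ny); transitivity (x * (g * y')); last by rewrite gy';
  comm_mul.
transitivity (f * y * g); first by comm_mul.
by rewrite fy; comm_mul.
Qed.

Lemma DVM_of_discrete : discrete_at M -> DVM L.
Proof.
move=> [x [nx gx dx]]; split.
  move=> full; have nzx : ~ zeros L (num x) by move/zeros_loc_frac.
  have : range (@quot_embed L) (@loc_frac L (nonzero_mulset L) 1 (num x) nzx).
    by rewrite full.
  move=> [w _ /loc_fracE]; rewrite mul1g mulC_canc => xw.
  have /multiples_loc_frac[f nMf [c fc]] :
    multiples (num x) (num 1) by exists w.
  by apply: nMf; rewrite -(mulg1 f) fc; apply: Mmul; case: gx.
move=> X sX; apply/principalP.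
case: (pselect (exists2 w, X w & ~ zeros L w)) => [[w]|nX]; last first.
  left; apply/seteqP; split=> w; last by rewrite sX; right.
  by move=> Xw; apply: contrapT => nw; apply: nX; exists w.
elim/loc_frac_ind: w => b s hs Xb nb'; right.
have Xmul v u : X v -> multiples v u -> X u.
  by move=> Xv [z ->]; apply: s_ideal_mul.
have nb : ~ zeros H b by move=> zb; apply: nb'; apply/zeros_loc_frac.
have exn : exists n, `[< X (num (x ^+ n)) >].
  have [n bx] := dx b nb; exists n; apply/asboolP; apply: Xmul Xb _.
  exact/multiples_loc_frac.
have [n /asboolP Xn minn] := ex_minnP exn.
exists (num (x ^+ n)); first by move/zeros_loc_frac; apply: nonzeroX.
apply/seteqP; split=> w; last exact: Xmul.
elim/loc_frac_ind: w => y t ht Xy; apply/multiples_loc_frac.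
case: (generator_valuation y n gx) => // -[k kn yk].
have /minn : `[< X (num (x ^+ k)) >].
  by apply/asboolP; apply: Xmul Xy _; apply/multiples_loc_frac.
by rewrite leqNgt kn.
Qed.

End DiscreteLocalization.

(** * Ideal systems with discrete localizations *)

Section DiscreteSystems.
Variables (H : cancMonoidType) (hHG : ~ eq_quot_monoid H).
Implicit Types (a b c e f g h x y z : H) (E F I J M X Y : set H).
Notation t := (t_ideal_system hHG).

Lemma max_nontrivial (q : ideal_system H) M : q_max q M -> ~ (M `<=` zeros H).
Proof.
move=> [_ _ maxM] Mz; have [u nu n1] := nonunit_exists hHG.
have [N MN uN] := q_max_exists (ideal_multiples q u) n1.
have [qN pN _] := MN; apply/nu/Mz.
rewrite -(maxM N) //; first by apply: uN; apply: multiples_refl.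
by move=> z /Mz; apply: (ideal_zeros qN).
Qed.

Lemma almost_DedekindP (r : ideal_system H) :
  almost_Dedekind r <-> forall M, q_max r M -> discrete_at M.
Proof.
split=> [[/hHG//|aD] M MM|dM].
  by apply: (discrete_of_DVM (hM := q_max_prime MM)) => //;
    apply: max_nontrivial MM.
by right=> M MM; apply: DVM_of_discrete; apply: dM.
Qed.

Lemma discrete_value (q : ideal_system H) M x b : prime_ideal q M ->
  generates M x ->
  (exists n, exists2 f, ~ M f & multiples b (f * x ^+ n)) ->
  exists n, (exists2 f, ~ M f & multiples (x ^+ n) (f * b)) /\
            (exists2 f, ~ M f & multiples b (f * x ^+ n)).
Proof.
move=> [qM nM1 prM] gx [n0 bx].
have exn : exists n, `[< exists2 f, ~ M f & multiples b (f * x ^+ n) >].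
  by exists n0; apply/asboolP.
have [n /asboolP bn minn] := ex_minnP exn; exists n; split=> //.
have hM : prime_s_ideal M.
  split=> //; first exact: (ideal_s_ideal qM).
  by move=> MT; apply: nM1; rewrite MT.
case: (generator_valuation hM b n gx) => // -[k kn bk].
have : (n <= k)%N by apply: minn; apply/asboolP.
by rewrite leqNgt kn.
Qed.

(** An element of least value in [E] locally divides all of [E].  The sets of
    elements locally divisible by a given nonzero [e] in [E], with a given
    denominator [f], are directed because values are totally ordered. *)
Lemma discrete_finite (q : ideal_system H) M E : prime_ideal q M ->
  discrete_at M -> finite_set E -> ~ (E `<=` zeros H) ->
  exists2 e, E e /\ ~ zeros H e & exists2 f, ~ M f &
    forall y, E y -> multiples e (f * y).
Proof.
move=> pM [x [nx gx dx]] finE /existsNP[e0 /not_implyP[Ee0 ne0]].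
have mM := prime_mul_closed pM.
pose R := [set i : H * H | [/\ E i.1, ~ zeros H i.1 & ~ M i.2]].
pose D (i : H * H) := [set y | multiples i.1 (i.2 * y)].
have weaken e f g : D (e, f) `<=` D (e, g * f).
  by move=> y ey; rewrite /D /= -mulgA; apply: multiples_mull.
have [|||[e f] [/= Ee ne nMf] EDe] := @finite_directed H _ R D E _ _ finE.
- by exists (e0, 1); split=> //; apply: mM.1.
- suff wlog e f e' f' n n' : R (e, f) -> R (e', f') -> (n <= n')%N ->
      (exists2 g, ~ M g & multiples e (g * x ^+ n)) ->
      (exists2 g, ~ M g & multiples (x ^+ n') (g * e')) ->
      exists2 k, R k & D (e, f) `|` D (e', f') `<=` D k.
    move=> [e f] [e' f'] Ref Ref'; have [_ /= ne _] := Ref;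
      have [_ /= ne' _] := Ref'.
    have [n [xe ex]] := discrete_value pM gx (dx e ne).
    have [n' [xe' ex']] := discrete_value pM gx (dx e' ne').
    case: (leqP n n') => [nn'|/ltnW nn']; first exact: wlog ex xe'.
    by rewrite setUC; apply: wlog ex' xe.
  move=> [/= Ee ne nMf] [/= Ee' ne' nMf'] nn' [g nMg ex] [g' nMg' xe'].
  have ee' : multiples e (g * g' * e').
    rewrite -mulgA; have [u ->] := xe'; rewrite -(subnKC nn') expgnDr.
    by rewrite !mulgA; do 2!apply: multiples_mulr.
  exists (e, g * g' * (f * f')); first by split=> //; do !apply: mM.2.
  move=> y [ey|e'y].
    have -> : g * g' * (f * f') = g * g' * f' * f by comm_mul.
    exact: weaken.
  have [u fy] : multiples e' (f' * y) := e'y.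
  have -> : g * g' * (f * f') = f * (g * g' * f') by comm_mul.
  apply: weaken; rewrite /D /= -mulgA fy mulgA; exact: multiples_mulr.
- move=> y Ey; case: (pselect (zeros H y)) => [zy|ny].
    exists (e0, 1); first by split=> //; apply: mM.1.
    by apply: multiples_zero; apply: zerosM_r.
  exists (y, 1); first by split=> //; apply: mM.1.
  by rewrite /D /= mul1g; apply: multiples_refl.
by exists e => //; exists f.
Qed.

(** A finite set has locally a generator, which generates its t-closure as well;
    so the t-closure is locally contained in the p-closure. *)
Lemma discrete_t_le (p r : ideal_system H) :
  (forall M, q_max r M -> discrete_at M) ->
  le_system t (modularization p r).
Proof.
move=> dM X x [E [EX finE] vx]; apply/modularizationP => M MM.
have pM := q_maxP MM; have [_ nM1 _] := pM.
case: (pselect (E `<=` zeros H)) => [Ez|nEz].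
  exists 1 => //; apply: zeros_sub_cl; apply: zerosM_r; apply: (v_zeros hHG).
  exact: v_mono vx.
have [e [Ee ne] [f nMf Ef]] := discrete_finite pM (dM M MM) finE nEz.
exists f => //; move/v_systemP: vx => /(_ f e ne Ef).
by apply: ideal_multiples_sub; [apply: cl_idem | apply: sub_cl; apply: EX].
Qed.

Lemma discrete_systems_eq (p r : ideal_system H) (p_le_r : le_system p r) :
  (forall M, q_max r M -> discrete_at M) ->
  (r : set H -> set H) = t_system H /\ modularization p r = t_system H.
Proof.
move=> dM; have tm := discrete_t_le p dM.
have rt := @le_t H r.
have mr : le_system (modularization p r) r := le_modularization p_le_r.
by split; apply/funext => X; apply/seteqP; split=> x;
  [exact: rt | move/tm; exact: mr | move/mr; exact: rt | exact: tm].
Qed.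

Definition inverse_product X : set H := @quot_embed H @^-1`
  set_mul (@quot_embed H @` X) (frac_inv (@quot_embed H @` X)).

Lemma inverse_productP X y : inverse_product X y <->
  exists a g h, [/\ X a, ~ zeros H h, forall x, X x -> multiples h (g * x)
    & y * h = a * g].
Proof.
split.
  move=> [_ [a Xa <-] [w + ]];
    elim/loc_frac_ind: w => g h nh /frac_inv_ratio gX.
  rewrite loc_fracM => /loc_fracE; rewrite mulg1 mulgA mulg1 => agy.
  by exists a, g, h; split=> //; rewrite -agy.
move=> [a [g [h [Xa nh gX yh]]]].
exists (quot_embed a); first by exists a.
exists (@loc_frac H (nonzero_mulset H) g h nh); first exact/frac_inv_ratio.
by rewrite loc_fracM; apply/loc_fracE; rewrite mulg1 mul1g yh.
Qed.

Lemma nonzero_of_invertible_at (q : ideal_system H) M X a s :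
  prime_ideal q M -> ~ (X `<=` zeros H) ->
  ~ M s -> (forall y, X y -> multiples a (s * y)) -> ~ zeros H a.
Proof.
move=> [qM _ _] /existsNP[x /not_implyP[Xx nx]] nMs aX za.
have := aX x Xx; rewrite multiples_of_zero // => /zeros_mul[|//].
by move/(ideal_zeros qM).
Qed.

Lemma t_invertible_of_local X : q_ideal t X -> ~ (X `<=` zeros H) ->
  (forall M, q_max t M -> invertible_at M X) -> q_invertible (t_system H) X.
Proof.
move=> tX nX iX; split=> //; apply: (@cl_one _ t).
apply: (@ideal_top _ t); first exact: (@cl_idem _ t).
move=> M MM; have [a [s [Xa nMs aX]]] := iX M MM.
exists s => //; apply: (@sub_cl _ t); apply/inverse_productP.
exists a, s, a; split=> //; last exact: mulC_canc.
exact: (nonzero_of_invertible_at (q_maxP MM) nX nMs aX).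
Qed.

Lemma invertible_at_of_t X M : q_invertible (t_system H) X -> q_max t M ->
  invertible_at M X.
Proof.
move=> [_ invX] MM; have [tM nM1 _] := q_maxP MM.
have [s [/inverse_productP[a [g [h [Xa nh gX sh]]]] nMs]] :
    exists s, inverse_product X s /\ ~ M s.
  apply: contrapT => nXM; apply: nM1.
  have : t_system H (inverse_product X) 1 by rewrite /inverse_product invX.
  apply: (@cl_min _ t) => // s Xs.
  by apply: contrapT => nMs; apply: nXM; exists s.
exists a, s; split=> // x /gX[u gxu]; exists u; apply: (canc_inj nh).
transitivity (s * h * x); first by comm_mul.
by rewrite sh -mulgA gxu; comm_mul.
Qed.

(** At a maximal [M] containing [x], some radical factor of [x H] inside [M] is
    locally [a H].  It contains the radical of [x H], and conversely a local
    multiple of [a] lies in this radical, as a power of [a] is locally a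
    multiple of [x]. *)
Lemma SP_radical_t_invertible (r : ideal_system H) x :
  (r : set H -> set H) = t_system H -> SP_monoid r ->
  (forall M, q_max r M -> discrete_at M) -> ~ zeros H x ->
  q_invertible (t_system H) (radical (multiples x)).
Proof.
move=> rt /SP_monoidP SP dM nx; apply: t_invertible_of_local.
- exact: (ideal_radical (ideal_multiples t x)).
- by move=> /(_ x (sub_radical (multiples_refl x))).
move=> M; rewrite -[q_max t]/(q_max (t_system H)) -rt => MM.
have pM := q_maxP MM; have [rM nM1 prM] := pM; have mM := prime_mul_closed pM.
case: (pselect (M x)) => [Mx|nMx]; last first.
  exists x, x; split=> //; last by move=> y _; apply: multiplesM.
  exact/sub_radical/multiples_refl.
have [K fK xK] := SP _ (ideal_multiples r x).
have KM : K `<=` M.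
  have xM : multiples x `<=` M := ideal_multiples_sub rM Mx.
  by move=> k Kk; apply: xM; rewrite xK; apply: sub_cl.
have xK1 : r (set_mul K [set 1]) = multiples x by rewrite set_mul1.
have [J [rJ radJ KJ JM [a [s [Ja nMs aJ]]]]] :=
  factored_radical_at pM nx xK1 fK KM.
have xJ : radical (multiples x) `<=` J.
  by rewrite -radJ; apply: radicalS; rewrite xK; apply: cl_min.
have [z [nz [Mz gz] dz]] := dM M MM.
have [g nMg [c gac]] := gz a (JM a Ja); have [n [f nMf xz]] := dz x nx.
exists (f * g * a), (f * g * s); split.
- exists n.+1 => //; rewrite -mulgA gac !expgMn_canc !expgS.
  have -> : f * f ^+ n * (z * z ^+ n * (c * c ^+ n)) =
            f * z ^+ n * (f ^+ n * z * (c * c ^+ n)) by comm_mul.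
  exact: multiples_mulr.
- by do 2?apply: mM.2.
- by move=> y /xJ/aJ; rewrite -(mulgA _ s y); apply: multiples_scale.
Qed.

End DiscreteSystems.

(** * Invertible radicals of principal ideals *)

Section InvertibleRadicals.
Variables (H : cancMonoidType) (hHG : ~ eq_quot_monoid H).
Implicit Types (a b c d e f g h k s u v w x y z : H).
Implicit Types (A B C E F I J K M P U X Y : set H).
Notation t := (t_ideal_system hHG).

Lemma radical_multiplesM a b :
  radical (multiples (a * b)) = radical (multiples a) `&` radical (multiples b).
Proof.
apply/seteqP; split=> y.
  move=> [n n0 [u yn]]; split; exists n => //; rewrite yn.
    by exists (b * u); rewrite mulgA.
  by exists (a * u); comm_mul.
move=> [[n n0 [u yn]] [m m0 [v ym]]]; exists (n + m)%N;
  first by rewrite addn_gt0 n0.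
by exists (u * v); rewrite expgnDr yn ym; comm_mul.
Qed.

Lemma inverse_product_choice X : exists ca cg ch : H -> H,
  forall y, inverse_product X y -> [/\ X (ca y), ~ zeros H (ch y),
    forall x, X x -> multiples (ch y) (cg y * x) & y * ch y = ca y * cg y].
Proof.
have /choice[F FP] : forall y, exists F : H * H * H, inverse_product X y ->
    [/\ X F.1.1, ~ zeros H F.2, forall x, X x -> multiples F.2 (F.1.2 * x)
    & y * F.2 = F.1.1 * F.1.2].
  move=> y.
  case: (pselect (inverse_product X y)) => [|nXy]; last by exists (1, 1, 1).
  by move=> /inverse_productP[a [g [h ?]]]; exists (a, g, h).
by exists (fun y => (F y).1.1), (fun y => (F y).1.2), (fun y => (F y).2).
Qed.

Lemma t_invertible_finite X : q_invertible (t_system H) X ->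
  exists F, [/\ finite_set F, F `<=` inverse_product X & v_system F 1].
Proof.
move=> [_ invX];
  have : t_system H (inverse_product X) 1 by rewrite /inverse_product invX.
by move=> [F [FX finF] vF]; exists F.
Qed.

Definition quotient h x : H := xget 1 [set u | x = h * u].

Lemma quotientP h x : multiples h x -> x = h * quotient h x.
Proof. by move=> hx; have := xgetPex (1 : H) hx. Qed.

(** The invertibility of [B] is witnessed by finitely many fractions; their
    products with the elements of [P] lie in [(C : B)], and a fraction [g / h]
    carrying these products into [H] carries [P] into [B]. *)
Lemma colon_finite B C P : q_invertible (t_system H) B -> q_ideal t C ->
  C `<=` B -> finite_set P -> P `<=` C ->
  exists U, [/\ finite_set U, U `<=` colon C B
    & forall g h, ~ zeros H h -> (forall u, U u -> multiples h (g * u)) ->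
        forall c, P c -> exists2 k, B k & g * c = h * k].
Proof.
move=> invB tC CB finP PC; have tB : q_ideal t B by case: invB.
have [F [finF FB vF]] := t_invertible_finite invB.
have [ca [cg [ch cP]]] := inverse_product_choice B.
pose U := [set quotient (ch w) (cg w * c) | w in F & c in P].
have quo w c : F w -> P c -> cg w * c = ch w * quotient (ch w) (cg w * c).
  by move=> /FB/cP[_ _ gB _] /PC/CB/gB; apply: quotientP.
exists U; split; first exact: finite_image2.
  move=> _ [w Fw [c Pc <-]] z Bz.
  have [_ nch gB _] := cP w (FB w Fw).
  have [z' gz] := gB z Bz.
  suff -> : quotient (ch w) (cg w * c) * z = c * z' by apply: (ideal_mulr _ tC); apply: PC.
  apply: (canc_inj nch); rewrite mulgA -quo // -mulgA [c * z]mulC_canc mulgA gz.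
  by comm_mul.
move=> g h nh gU c Pc.
have key w : F w -> exists2 v, B (ca w * v) & g * c * w = h * (ca w * v).
  move=> Fw; have [Bca nch gB wch] := cP w (FB w Fw).
  have [v guv] : multiples h (g * quotient (ch w) (cg w * c)).
    by apply: gU; exists w => //; exists c.
  exists v; first exact: (ideal_mulr _ tB).
  apply: (canc_inj nch); transitivity (g * c * (w * ch w)); first by comm_mul.
  rewrite wch; transitivity (g * ca w * (cg w * c)); first by comm_mul.
  rewrite quo //; transitivity (ch w * ca w * (g * quotient (ch w) (cg w * c))).
    by comm_mul.
  by rewrite guv; comm_mul.
have [k gck] : multiples h (g * c).
  rewrite -[g * c]mulg1; move/v_systemP: vF; apply=> // w /key[v _ ->].
  exact: multiplesM.
exists k => //; rewrite -(mulg1 k).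
have : t_system H (mul k @` F) (k * 1).
  by apply: t_finite; [apply: finite_image | apply: v_scale].
apply: (@cl_min _ t) => // _ [w Fw <-]; have [v Bv gcw] := key w Fw.
suff -> : k * w = ca w * v by [].
by apply: (canc_inj nh); rewrite mulgA -gck.
Qed.

(** Let [C] be the intersection of [A] and [B].  A fraction [z] that carries both
    colon ideals [(C : A)] and [(C : B)] into [H] carries [C] into [A] and into
    [B], hence into [C], so that [z] is in [H].  Finitely many elements of the
    colon ideals suffice for this, so the two ideals are not both contained in
    the maximal t-ideal [M]; and [f] in [(C : A)] means that [f A] is contained
    in [B]. *)
Lemma locally_comparable A B M : q_invertible (t_system H) A ->
  q_invertible (t_system H) B -> q_invertible (t_system H) (A `&` B) ->
  q_max t M ->
  exists2 f, ~ M f & (forall y, A y -> B (f * y)) \/ (forall y, B y ->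
    A (f * y)).
Proof.
move=> invA invB invC MM; have tC : q_ideal t (A `&` B) by case: invC.
have [tM nM1 _] := q_maxP MM.
have [F [finF FC vF]] := t_invertible_finite invC.
have [ca [cg [ch cP]]] := inverse_product_choice (A `&` B).
have finP : finite_set (ca @` F) := finite_image ca finF.
have PC : ca @` F `<=` A `&` B by move=> _ [y /FC/cP[Cca _ _ _] <-].
have [U [finU UA gU]] := colon_finite invA tC (@subIsetl _ A B) finP PC.
have [V [finV VB gV]] := colon_finite invB tC (@subIsetr _ A B) finP PC.
have UV1 : t_system H (U `|` V) 1.
  apply: t_finite; first by rewrite finite_setU.
  apply/v_systemP => g h nh gUV; move/v_systemP: vF; apply=> // y Fy.
  have [_ nch gC ych] := cP y (FC y Fy).
  have [||k Ak gk] := gU g h nh _ (ca y); first by move=> u Uu; apply: gUV;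
    left.
    by exists y.
  have [||k' Bk' gk'] := gV g h nh _ (ca y); first by move=> v Vv; apply: gUV;
    right.
    by exists y.
  have kk' : k' = k by apply: (canc_inj nh); rewrite -gk -gk'.
  rewrite {}kk' in Bk'; have [|m gkm] := gC k; first by split.
  exists m; apply: (canc_inj nch); transitivity (g * (y * ch y));
    first by comm_mul.
  rewrite ych; transitivity (g * ca y * cg y); first by comm_mul.
  by rewrite gk -mulgA [k * _]mulC_canc gkm; comm_mul.
have [f [UVf nMf]] : exists f, (U `|` V) f /\ ~ M f.
  apply: contrapT => UVM; apply: nM1; move: UV1;
    apply: (@cl_min _ t) => // f UVf.
  by apply: contrapT => nMf; apply: UVM; exists f.
exists f => //; case: UVf => [/UA fA|/VB fB].
  by left=> y /fA[].
by right=> y /fB[].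
Qed.

Hypothesis invR : forall x, ~ zeros H x ->
  q_invertible (t_system H) (radical (multiples x)).

(** Let [x] be a local generator of the radical of [a H].  It divides locally
    each nonzero [b] in [M]: otherwise comparability of radicals would write [x]
    locally as a product [y c] of elements of [M] such that [y H] and [c H] are
    locally radical, hence comparable, and [x] would have a square factor in
    [M]; but then [x] would not generate a radical ideal. *)
Lemma radical_generator M a : q_max t M -> M a -> ~ zeros H a ->
  exists x, [/\ radical (multiples a) x, generates M x & exists2 s, ~ M s
    & forall y, radical (multiples a) y -> multiples x (s * y)].
Proof.
move=> MM Ma na; have pM := q_maxP MM; have [tM nM1 prM] := pM.
have mM := prime_mul_closed pM.
have Mnz f : ~ M f -> ~ zeros H f by move=> nMf /(ideal_zeros tM).
set A := radical (multiples a).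
have tA : q_ideal t A by apply: (@ideal_radical _ t); apply: ideal_multiples.
have radA : radical A = A by apply: radicalK.
have AM : A `<=` M.
  by move=> y [n _] /(ideal_multiples_sub tM Ma); apply: (primeX pM).
have nA : ~ (A `<=` zeros H) by move=> /(_ a (sub_radical (multiples_refl a))).
have [x [s [Ax nMs Axs]]] := invertible_at_of_t (invR na) MM.
have nx : ~ zeros H x := nonzero_of_invertible_at pM nA nMs Axs.
(* If [u x = e^2 d], then [e d] is in the radical ideal [A], hence is locally a
   multiple of [x], and [e] is a local unit. *)
have nosquare u d e : ~ M u -> M e -> u * x = e * e * d -> False.
  move=> nMu Me ux.
  have ned : ~ zeros H (e * d).
    apply: (@nonzeroM_r _ e); rewrite mulgA -ux; apply: nonzeroM => //;
      exact: Mnz.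
  have Aed : A (e * d).
    apply: (radicalX (n := 1)) => //; rewrite expg2.
    have -> : e * d * (e * d) = x * (u * d).
      transitivity (e * e * d * d); first by comm_mul.
      by rewrite -ux; comm_mul.
    exact: (ideal_mulr _ tA).
  have [c sed] := Axs _ Aed.
  have : ~ M (u * s) by apply: mM.2.
  apply; suff -> : u * s = e * c by apply: (ideal_mulr _ tM).
  apply: (canc_inj ned); transitivity (u * (s * (e * d))); first by comm_mul.
  rewrite sed; transitivity (u * x * c); first by comm_mul.
  by rewrite ux; comm_mul.
exists x; split=> //; last by exists s.
split; first exact: AM.
have comparable b c : ~ zeros H b -> ~ zeros H c -> exists2 f, ~ M f &
    (forall y, radical (multiples b) y -> radical (multiples c) (f * y)) \/
    (forall y, radical (multiples c) y -> radical (multiples b) (f * y)).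
  move=> nb nc; apply: locally_comparable => //; try exact: invR.
  by rewrite -radical_multiplesM; apply/invR/nonzeroM.
move=> b Mb; case: (pselect (zeros H b)) => [zb|nb].
  by exists 1 => //; apply: multiples_zero; apply: zerosM_r.
have Bb : radical (multiples b) b by apply/sub_radical/multiples_refl.
have [f nMf [fAB|fBA]] := comparable a b na nb; last first.
  exists (s * f); first exact: mM.2.
  by rewrite -mulgA; apply/Axs/fBA.
have nB : ~ (radical (multiples b) `<=` zeros H) by move=> /(_ b Bb).
have [y [s' [By nMs' Bys']]] := invertible_at_of_t (invR nb) MM.
have ny : ~ zeros H y := nonzero_of_invertible_at pM nB nMs' Bys'.
have My : M y.
  by move: By => [n _] /(ideal_multiples_sub tM Mb); apply: (primeX pM).
have [c Fx] := Bys' _ (fAB x Ax).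
have nMF : ~ M (s' * f) by apply: mM.2.
rewrite mulgA in Fx.
case: (pselect (M c)) => [Mc|nMc]; last first.
  exists (c * s'); first exact: mM.2.
  have [d yd] : multiples y (s' * b) by apply: Bys'.
  exists (s' * f * d); transitivity (c * (s' * b)); first by comm_mul.
  rewrite yd; transitivity (y * c * d); first by comm_mul.
  by rewrite -Fx; comm_mul.
exfalso.
have nc : ~ zeros H c.
  by apply: (@nonzeroM_r _ y); rewrite -Fx; apply: nonzeroM => //; apply: Mnz.
(* [c] is locally radical, like [x] *)
have cdiv z : radical (multiples c) z -> multiples c (s' * f * s * z).
  move=> [[//|n] _ [e zn]].
  have [h szy] : multiples x (s * (z * y)).
    apply: Axs; rewrite -/A -radA; exists n.+1 => //.
    suff -> : (z * y) ^+ n.+1 = x * (s' * f * e * y ^+ n) by apply: (ideal_mulr _ tA).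
    rewrite expgMn_canc zn expgS; transitivity (y * c * (e * y ^+ n));
      first by comm_mul.
    by rewrite -Fx; comm_mul.
  exists h; apply: (canc_inj ny); transitivity (s' * f * (s * (z * y))).
    by comm_mul.
  rewrite szy; transitivity (s' * f * x * h); first by comm_mul.
  by rewrite Fx; comm_mul.
have [f' nMf' [fBC|fCB]] := comparable b c nb nc.
  have [d cd] := cdiv _ (fBC y By).
  apply: (nosquare (s' * f * s * f' * (s' * f)) d c) => //.
    by do !apply: mM.2.
  rewrite -mulgA Fx; transitivity (s' * f * s * (f' * y) * c);
    first by comm_mul.
  by rewrite cd; comm_mul.
have [d yd] := Bys' _ (fCB c (sub_radical (multiples_refl c))).
apply: (nosquare (s' * f' * (s' * f)) d y) => //; first by do !apply: mM.2.
rewrite -mulgA Fx; transitivity (s' * (f' * c) * y); first by comm_mul.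
by rewrite yd; comm_mul.
Qed.

End InvertibleRadicals.

Section RadicalFactorization.
Variables (H : cancMonoidType) (p r : ideal_system H) (p_le_r : le_system p r).
Hypothesis zeros_ideal : q_ideal r (zeros H).
Implicit Types (x y z : H) (I J K M X : set H).
Notation m := (modularization_system p r).

Hypothesis radical_gen : forall M x, q_max r M -> M x -> ~ zeros H x ->
  exists z, [/\ radical (multiples x) z, generates M z & exists2 s, ~ M s
    & forall y, radical (multiples x) y -> multiples z (s * y)].

(** At a maximal ideal [M] containing [I], the radicals of [x H] and of [I] are
    both locally equal to [M], and have a common local generator [z] by which
    the elements of [I] can be divided; elsewhere all the ideals are locally
    trivial. *)
Lemma radical_colon_product I x : q_ideal m I -> ~ zeros H x ->
  radical (multiples x) `<=` radical I ->
  I = m (set_mul (radical I) (colon I (radical (multiples x)))).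
Proof.
move=> mI nx xI; set C := colon _ _.
have mP : q_ideal m (m (set_mul (radical I) C)) by apply: (@cl_idem _ m).
have xI' : radical I x by apply/xI/sub_radical/multiples_refl.
apply/seteqP; split=> y.
  move=> Iy; apply: (modularization_local mP) => M MM.
  have pM := q_maxP MM; have [rM nM1 _] := pM; have mM := prime_mul_closed pM.
  case: (pselect (I `<=` M)) => [IM|/existsNP[f /not_implyP[If nMf]]];
    last first.
    exists (f * f); first exact: mM.2.
    rewrite -mulgA; apply: (@sub_cl _ m); apply: set_mulP;
      first exact: sub_radical.
    by apply: (sub_colon mI); apply: (ideal_mulr _ mI).
  have RIM : radical I `<=` M by move=> w [n _ /IM]; apply: (primeX pM).
  have [z [Xz [_ gz] [s nMs Xs]]] := radical_gen MM (RIM _ xI') nx.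
  have [f nMf [h fy]] := gz y (IM y Iy).
  exists (s * f); first exact: mM.2.
  rewrite -mulgA fy mulgCA; apply: (@sub_cl _ m); apply: set_mulP;
    first exact: xI.
  move=> w Xw; have [u sw] := Xs w Xw.
  have -> : s * h * w = f * y * u.
    by transitivity (s * w * h); [comm_mul | rewrite sw fy; comm_mul].
  by apply: (ideal_mulr _ mI); apply: (ideal_mull _ mI).
apply: (@cl_min _ m) => // _ [{}y Ry [w Cw <-]].
apply: (modularization_local mI) => M MM.
have pM := q_maxP MM; have [rM nM1 _] := pM; have mM := prime_mul_closed pM.
case: (pselect (I `<=` M)) => [IM|/existsNP[f /not_implyP[If nMf]]]; last first.
  by exists f => //; apply: (ideal_mulr _ mI).
have RIM : radical I `<=` M by move=> v [n _ /IM]; apply: (primeX pM).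
have [z [Xz [_ gz] _]] := radical_gen MM (RIM _ xI') nx.
have [f nMf [h fy]] := gz y (RIM y Ry).
exists f => //; rewrite mulgA fy.
have -> : z * h * w = w * z * h by comm_mul.
by apply: (ideal_mulr _ mI); apply: Cw.
Qed.

(** If [M] contained all the iterated colon ideals, then a local generator [z] of
    the radical of [x H] at [M] would have a power in [x H], although [n]
    divisions by the radical take [z ^+ n] to a local unit. *)
Lemma iter_colon_top I x : q_ideal m I -> ~ zeros H x -> I x ->
  exists n, iter n (fun J => colon J (radical (multiples x))) I 1.
Proof.
move=> mI nx Ix; set X := radical _; pose D n := iter n (fun J => colon J X) I.
have mD n : q_ideal m (D n) by elim: n => // n IHn; apply: (@ideal_colon _ m).
have DS n k : D n `<=` D (k + n)%N.
  elim: k => // k IHk; apply: (subset_trans IHk); exact: (sub_colon (mD _)).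
have mU : q_ideal m (\bigcup_(n in setT) D n).
  apply: (@ideal_directed _ m) => //.
  move=> i j _ _; exists (j + i)%N => // y [|]; first exact: DS.
  by rewrite addnC; apply: DS.
apply: contrapT => nD.
have [|M + UM] := q_max_exists mU; first by move=> [n _ Dn]; apply: nD;
  exists n.
rewrite -[q_max m]/(q_max (modularization p r)) (modularization_max p_le_r) => MM.
have pM := q_maxP MM; have mM := prime_mul_closed pM.
have Mx : M x by apply: UM; exists 0%N.
have [z [[n _ xz] _ [s nMs Xs]]] := radical_gen MM Mx nx.
have lower j k y : D k (y * z ^+ j) -> D (j + k)%N (y * s ^+ j).
  elim: j k y => [|j IHj] k y; first by rewrite !expg0.
  move=> Dk; rewrite addSnnS expgS mulgA; apply: IHj => w Xw.
  have [u sw] := Xs w Xw.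
  suff -> : y * s * z ^+ j * w = y * z ^+ j.+1 * u by apply: (ideal_mulr _ (mD k)).
  by transitivity (y * z ^+ j * (s * w)); [comm_mul | rewrite sw expgS;
    comm_mul].
have : M (s ^+ n).
  apply: UM; exists (n + 0)%N => //; rewrite -(mul1g (s ^+ n)); apply: lower.
  by rewrite mul1g; apply: (ideal_multiples_sub mI Ix).
by move/(primeX pM).
Qed.

Lemma SP_of_radical_generator : SP_monoid m.
Proof.
apply/SP_monoidP => I mI.
case: (pselect (I `<=` zeros H)) => [Iz|/existsNP[x /not_implyP[Ix nx]]].
  have {Iz} -> : I = zeros H.
    by apply/seteqP; split=> // z; apply: (ideal_zeros mI).
  have mz : q_ideal m (zeros H) := ideal_modularization p_le_r zeros_ideal.
  exists (set_mul (zeros H) [set 1]); last by rewrite set_mul1 mz.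
  apply: factoredM; [exact: mz | | exact: factored1].
  apply/seteqP; split; last exact: sub_radical.
  by move=> z [n _ zn]; apply: contrapT => nz; exact: (@nonzeroX _ z n nz zn).
have [n] := iter_colon_top mI nx Ix.
have : radical (multiples x) `<=` radical I.
  by apply: radicalS; apply: (ideal_multiples_sub mI).
elim: n I mI {Ix} => [|n IHn] I mI xI.
  by move=> I1; exists [set 1]; rewrite ?(ideal1 mI I1) ?cl1 //;
    apply: factored1.
rewrite iterSr => In.
have mC : q_ideal m (colon I (radical (multiples x))) by apply: (@ideal_colon _ m).
have [|//|K fK CK] := IHn _ mC.
  by apply: (subset_trans xI); apply: radicalS; apply: (sub_colon mI).
exists (set_mul (radical I) K).
  by apply: factoredM => //; [apply: (@ideal_radical _ m) | apply: radicalK].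
rewrite {1}(radical_colon_product mI nx xI) CK.
exact: (@cl_set_mulr _ m).
Qed.

End RadicalFactorization.

(** * The Bezout property *)

Section FinitelyGeneratedFactors.
Variables (H : cancMonoidType) (q : ideal_system H).
Implicit Types (a x y : H) (E F I J K : set H).

Lemma nontrivialP I : q_ideal q I -> nontrivial I <-> ~ (I `<=` zeros H).
Proof. by move=> qI; split=> [[]//|nI]; split=> //; apply: ideal_zeros qI. Qed.

Lemma q_fin_gen_cl E : finite_set E -> q_fin_gen q (q E).
Proof. by move=> finE; split; [apply: cl_idem | exists E; split=> //;
  apply: sub_cl]. Qed.

Lemma cl_multiples_mul a K : q (set_mul (multiples a) K) = mul a @` q K.
Proof.
rewrite -(cl_set1 q) cl_set_mull cl_scale; congr (cl _ _).
by apply/seteqP; split=> [_ [_ -> [k Kk <-]]|_ [k Kk <-]];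
  [exists k | apply: set_mulP].
Qed.

Lemma mul_multiples a x : mul a @` multiples x = multiples (a * x).
Proof.
apply/seteqP; split=> [_ [_ [u ->] <-]|_ [u ->]]; first by exists u;
  rewrite mulgA.
by exists (x * u); [exists u | rewrite mulgA].
Qed.

Lemma image_mul_inj a E F : ~ zeros H a -> mul a @` E = mul a @` F -> E = F.
Proof.
move=> na EF; have sub X Y : mul a @` X = mul a @` Y -> X `<=` Y.
  move=> XY x Xx; have : (mul a @` X) (a * x) by exists x.
  by rewrite XY => -[y Yy /(canc_inj na) <-].
by apply/seteqP; split; apply: sub.
Qed.

(** Finitely many elements [F] of [J] suffice to write the generators [E] as
    elements of the product with [K].  Then [J E] is contained in the closure
    of [F E], and [E] cancels. *)
Lemma factor_fin_gen J K E : q_ideal q J -> finite_set E ->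
  q (set_mul J K) = q E ->
  (forall F y, (forall i, q E i -> q (set_mul F (q E)) (y * i)) -> q F y) ->
  q_fin_gen q J.
Proof.
move=> qJ finE JKE cancelE; split=> //.
have monoD F F' : F `<=` F' -> q (set_mul F K) `<=` q (set_mul F' K).
  by move=> FF'; apply: cl_mono => _ [z /FF' ? [k ? <-]]; apply: set_mulP.
have dirD := finite_subsets_directed (X := J) monoD.
have [|F [FJ finF] EF] := finite_directed (finite_subsets0 J) dirD finE.
  move=> e Ee; have : q (set_mul J K) e by rewrite JKE; apply: sub_cl.
  apply: cl_min.
    apply: (ideal_directed (finite_subsets0 J) dirD) => F _; exact: cl_idem.
  move=> _ [j Jj [k Kk <-]]; exists [set j].
    by split; [move=> _ -> | apply: finite_set1].
  by apply: sub_cl; apply: set_mulP.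
exists F; split=> //; apply/seteqP; split; last exact: cl_min.
move=> y Jy; apply: cancelE => i Ei.
have : q (set_mul F K) i by move: Ei; apply: cl_min => //; apply: cl_idem.
move=> /(cl_scaled y); apply: cl_mono => _ [_ [z Fz [k Kk <-]] <-].
by rewrite mulgCA; apply: set_mulP => //; rewrite -JKE; apply: sub_cl;
  apply: set_mulP.
Qed.

Lemma cancel_multiples x F y : ~ zeros H x ->
  (forall i, multiples x i -> q (set_mul F (multiples x)) (y * i)) -> q F y.
Proof.
move=> nx /(_ x (multiples_refl x));
  rewrite set_mulC cl_multiples_mul mulC_canc.
by move=> [z Fz /(canc_inj nx) <-].
Qed.

End FinitelyGeneratedFactors.

Section BezoutSystem.
Variables (H : cancMonoidType) (hHG : ~ eq_quot_monoid H) (r : ideal_system H).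
Hypothesis bezout : Bezout r.
Implicit Types (x y z d j : H) (E X K : set H).

Lemma Bezout_principal E : finite_set E -> ~ (E `<=` zeros H) ->
  exists2 d, ~ zeros H d & r E = multiples d.
Proof.
move=> finE nE.
have nrE : nontrivial (r E).
  apply/nontrivialP; first exact: cl_idem.
  by move=> rEz; apply: nE; apply: subset_trans rEz; apply: sub_cl.
exact: (nontrivial_principal (bezout (q_fin_gen_cl r finE) nrE) nrE).
Qed.

(** Finitely generated ideals are principal, hence divisorial. *)
Lemma Bezout_eq_t : (r : set H -> set H) = t_system H.
Proof.
apply/funext => X; apply/seteqP; split; first exact: le_t.
move=> x [E [EX finE] vx].
case: (pselect (E `<=` zeros H)) => [Ez|nE].
  by apply: zeros_sub_cl; apply: (v_zeros hHG); apply: v_mono vx.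
have [d _ rE] := Bezout_principal finE nE.
have : r E x.
  by rewrite rE; apply: (v_multiples hHG) vx; rewrite -rE; apply: sub_cl.
exact: cl_mono.
Qed.

(** The intersection is generated by [j d / g], where [g] generates the ideal of
    [j] and [d]. *)
Lemma Bezout_lcm j d : ~ zeros H j -> ~ zeros H d ->
  principal (multiples j `&` multiples d).
Proof.
move=> nj nd.
have [||g ng rg] := @Bezout_principal [set j; d].
- by rewrite finite_setU; split; apply: finite_set1.
- by move=> /(_ j (or_introl erefl)).
have [j' jE] : multiples g j by rewrite -rg; apply: sub_cl; left.
have [d' dE] : multiples g d by rewrite -rg; apply: sub_cl; right.
suff -> : multiples j `&` multiples d = multiples (j' * d) by apply: principal_multiples.
apply/seteqP; split=> z; last first.
  move=> [u ->]; split; last by exists (j' * u); comm_mul.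
  by exists (d' * u); rewrite dE jE; comm_mul.
move=> [[u zj] [v zd]]; apply: (multiples_cancel ng).
have : r [set j; d] g by rewrite rg; apply: multiples_refl.
move=> /(cl_scaled z); rewrite [g * z]mulC_canc; apply: cl_min;
  first exact: ideal_multiples.
move=> _ [_ [->|->] <-].
  by exists v; rewrite zd [in LHS]jE; comm_mul.
by exists u; rewrite zj [in LHS]jE; comm_mul.
Qed.

(** The radical factors of [x H] are finitely generated, hence principal, and the
    radical of [x H] is their intersection. *)
Lemma Bezout_radical_principal : SP_monoid r ->
  forall X, principal X -> principal (radical X).
Proof.
move=> /SP_monoidP SP X /principalP[->|[x nx ->]].
  suff -> : radical (zeros H) = zeros H by apply/principalP; left.
  apply/seteqP; split; last exact: sub_radical.
  by move=> z [n _ zn]; apply: contrapT => nz; apply: (@nonzeroX _ z n nz zn).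
have [K fK /esym] := SP _ (ideal_multiples r x).
elim: fK x nx => {K} [|J K rJ radJ fK IHK] x nx.
  rewrite cl1 => <-; have -> : radical setT = multiples (1 : H).
    by apply/seteqP; split=> y _; [exists y; rewrite mul1g | exists 1%N].
  exact: principal_multiples.
move=> JKx.
have fgJ : q_fin_gen r J.
  apply: (factor_fin_gen (K := K) (E := [set x])) => //;
    first by rewrite cl_set1.
  by move=> F y; rewrite cl_set1; apply: cancel_multiples.
have Jx : J x.
  have : r (set_mul J K) x by rewrite JKx; apply: multiples_refl.
  by apply: cl_min => //; apply: (set_mul_subl rJ).
have nJ : nontrivial J by apply/(nontrivialP rJ) => /(_ x Jx).
have [j nj JE] := nontrivial_principal (bezout fgJ nJ) nJ.
have [x' xE] : multiples j x by rewrite -JE.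
have nx' : ~ zeros H x' by apply: (@nonzeroM_r _ j); rewrite -xE.
have Kx' : r K = multiples x'.
  apply: (image_mul_inj nj).
  by rewrite -cl_multiples_mul -JE JKx xE mul_multiples.
have [R0|[d nd Rd]] := (principalP _).1 (IHK x' nx' Kx').
  by case: nx'; rewrite -R0; apply/sub_radical/multiples_refl.
by rewrite xE radical_multiplesM -JE radJ Rd JE; apply: Bezout_lcm.
Qed.

End BezoutSystem.

Section PrincipalRadicals.
Variables (H : cancMonoidType) (hHG : ~ eq_quot_monoid H) (q : ideal_system H).
Hypothesis q_t : (q : set H -> set H) = t_system H.
Hypothesis prinR : forall X : set H, principal X -> principal (radical X).
Implicit Types (b c d e g h u v w x y z : H) (D E F J K : set H).

(** If [D = x H] and [E = y H], then the radical of [x y H] is the intersection of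
    [D] and [E]; its generator is a least common multiple of [x] and [y], so
    [x y] divided by it is a greatest common divisor, in the strong sense that
    it lies in the divisorial closure. *)
Lemma radical_gcd D E : principal D -> radical_set D -> principal E ->
  radical_set E -> principal (q (D `|` E)) /\ radical_set (q (D `|` E)).
Proof.
have zE E' : principal E' -> radical_set E' ->
    principal (q (zeros H `|` E')) /\ radical_set (q (zeros H `|` E')).
  move=> pE radE.
  have qE : q_ideal q E'.
    case/principalP: pE => [->|[x _ ->]]; last exact: ideal_multiples.
    exact: ideal_zeros_set.
  have -> : zeros H `|` E' = E'.
    by apply/seteqP; split=> [z [|//]|z]; [apply: (ideal_zeros qE) | right].
  by rewrite qE.
move=> pD radD pE radE.
case/principalP: (pD) => [->|[x nx DE]]; first exact: zE.
case/principalP: (pE) => [->|[y ny EE]]; first by rewrite setUC; apply: zE.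
rewrite {}DE {}EE in radD radE *.
have Rxy : radical (multiples (x * y)) = multiples x `&` multiples y.
  by rewrite radical_multiplesM radD radE.
have [Rz|[l nl Rl]] := (principalP _).1 (prinR (principal_multiples (x * y))).
  case: (nonzeroM nx ny); rewrite -[zeros _ _]/(zeros H (x * y)) -Rz.
  exact/sub_radical/multiples_refl.
have [[y' lx] [x' ly]] : (multiples x `&` multiples y) l.
  by rewrite -Rxy Rl; apply: multiples_refl.
have [d xyl] : multiples l (x * y).
  by rewrite -Rl; apply/sub_radical/multiples_refl.
have yE : y = y' * d by apply: (canc_inj nx); rewrite mulgA -lx.
have xE : x = x' * d.
  by apply: (canc_inj ny); rewrite mulgA -ly mulC_canc.
have -> : q (multiples x `|` multiples y) = multiples d.
  apply/seteqP; split.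
    apply: cl_min; first exact: ideal_multiples.
    by move=> _ [|] [u ->]; [exists (x' * u); rewrite xE | exists (y' * u);
      rewrite yE];
      comm_mul.
  apply: ideal_multiples_sub; first exact: cl_idem.
  rewrite q_t; exists [set x; y].
    split; last by rewrite finite_setU; split; apply: finite_set1.
    by move=> _ [->|->]; [left|right]; apply: multiples_refl.
  apply/v_systemP => g h nh gxy.
  have [u gx] := gxy x (or_introl erefl); have [v gy] :=
    gxy y (or_intror erefl).
  have uv : u * y = v * x.
    apply: (canc_inj nh); rewrite mulgA -gx [RHS]mulgA -gy; comm_mul.
  have [w uyw] : multiples l (u * y).
    rewrite -Rl Rxy; split; first by rewrite uv; apply: multiples_mull;
      apply: multiples_refl.
    by apply: multiples_mull; apply: multiples_refl.
  exists w; apply: (canc_inj nl); transitivity (g * (x * y)).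
    by rewrite xyl; comm_mul.
  by rewrite mulgA gx -mulgA uyw; comm_mul.
split; first exact: principal_multiples.
apply/seteqP; split; last exact: sub_radical.
move=> z [[//|n] _ [k zn]].
have : multiples y (z * y').
  apply: (radicalX (n := n) radE); rewrite expgMn_canc zn expgS yE.
  by exists (k * y' ^+ n); comm_mul.
rewrite yE => -[u zyu]; exists u.
have ny' : ~ zeros H y' by apply: (@nonzeroM_l _ _ d); rewrite -yE.
by apply: (canc_inj ny'); rewrite mulC_canc zyu mulgA.
Qed.

(** The ideal is generated by the principal radicals of its generators, which are
    combined by greatest common divisors. *)
Lemma radical_fin_gen_principal J : q_fin_gen q J -> radical_set J ->
  principal J.
Proof.
move=> [qJ [E [/finite_seqP[s ->] EJ JE]]] radJ.
have -> : J = q (\bigcup_(e in [set` s]) radical (multiples e)).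
  apply/seteqP; split.
    rewrite {1}JE; apply: cl_mono => e se; exists e => //.
    exact/sub_radical/multiples_refl.
  apply: cl_min => // z [e se]; rewrite -radJ; apply: radicalS.
  by apply: (ideal_multiples_sub qJ); apply: EJ.
suff [] : principal (q (\bigcup_(e in [set` s]) radical (multiples e))) /\
    radical_set (q (\bigcup_(e in [set` s]) radical (multiples e))) by [].
elim: s {EJ JE} => [|e s [pD radD]].
  have -> : \bigcup_(e in [set` [::]]) radical (multiples e) = set0 :> set H.
    by apply/seteqP; split=> // z [e]; rewrite /= in_nil.
  have -> : q set0 = zeros H.
    apply/seteqP; split; last exact: zeros_sub_cl.
    by apply: cl_min; first exact: ideal_zeros_set.
  split; first by apply/principalP; left.
  apply/seteqP; split; last exact: sub_radical.
  by move=> z [n _ zn]; apply: contrapT => nz; apply: (@nonzeroX _ z n nz zn).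
have -> : q (\bigcup_(z in [set` e :: s]) radical (multiples z)) =
    q (q (\bigcup_(z in [set` s]) radical (multiples z)) `|` radical (multiples e)).
  apply/seteqP; split.
    apply: cl_mono => z [w /=]; rewrite in_cons => /orP[/eqP->|sw] Rz;
      first by right.
    by left; apply: sub_cl; exists w.
  apply: cl_min; first exact: cl_idem.
  move=> z [|Rz]; last by apply: sub_cl; exists e => //=; rewrite in_cons eqxx.
  by apply: cl_mono => {}z [w sw Rz]; exists w => //=;
    rewrite in_cons [X in _ || X]sw orbT.
apply: radical_gcd => //; first exact/prinR/principal_multiples.
exact: radicalK.
Qed.

Hypothesis cancelE : forall E F y, finite_set E -> ~ (E `<=` zeros H) ->
  (forall i, q E i -> q (set_mul F (q E)) (y * i)) -> q F y.

(** The radical factors of a finitely generated ideal are finitely generated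
    because the ideal cancels; so they are principal. *)
Lemma Bezout_of_principal_radicals : SP_monoid q -> Bezout q.
Proof.
move=> /SP_monoidP SP I [qI [E [finE EI IE]]] /(nontrivialP qI).
move=> nI; have nE : ~ (E `<=` zeros H).
  by move=> Ez; apply: nI; rewrite IE; apply: cl_min => //;
    apply: ideal_zeros_set.
have [K fK IK] := SP _ qI.
have {IE}KE : q K = q E by rewrite -IK.
rewrite {}IK {I qI EI nI}.
elim: fK E finE nE KE => {K} [|J K qJ radJ fK IHK] E finE nE JKE.
  rewrite cl1; have -> : setT = multiples (1 : H).
    by apply/seteqP; split=> // y _; exists y; rewrite mul1g.
  exact: principal_multiples.
have EJ : E `<=` J.
  move=> e Ee; have : q (set_mul J K) e by rewrite JKE; apply: sub_cl.
  by apply: cl_min => //; apply: (set_mul_subl qJ).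
have fgJ : q_fin_gen q J.
  by apply: (factor_fin_gen (K := K) (E := E)) => // F y; apply: cancelE.
have [Jz|[j nj JE]] := (principalP _).1 (radical_fin_gen_principal fgJ radJ).
  by case: nE; rewrite -Jz.
pose E' := [set e | E (j * e)].
have EE' : E = mul j @` E'.
  apply/seteqP; split=> [e Ee|_ [e Ee <-]//].
  by have := EJ e Ee; rewrite JE => -[u eu]; exists u; rewrite /E' /= -?eu.
have KE' : q K = q E'.
  by apply: (image_mul_inj nj); rewrite -cl_multiples_mul -JE JKE EE' cl_scale.
have finE' : finite_set E'.
  apply: (sub_finite_set (B := mul j @^-1` E)) => //.
  by apply: finite_preimage => // u v _ _; apply: canc_inj.
have nE' : ~ (E' `<=` zeros H).
  by move=> Ez; apply: nE; rewrite EE' => _ [e /Ez ze <-]; apply: zerosM_r.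
have [K0|[d nd Kd]] := (principalP _).1 (IHK E' finE' nE' KE').
  by case: nE'; rewrite -K0 KE'; apply: sub_cl.
rewrite JE cl_multiples_mul Kd mul_multiples; exact: principal_multiples.
Qed.

End PrincipalRadicals.

(** * The equivalences *)

Section Equivalences.
Variables (H : cancMonoidType) (p r : ideal_system H).
Hypotheses (hHG : ~ eq_quot_monoid H) (p_le_r : le_system p r).
Implicit Types (x y : H) (E F M X : set H).
Notation m := (modularization_system p r).

(** Locally [E] generates a principal ideal. *)
Lemma discrete_cancel E F y : (forall M, q_max r M -> discrete_at M) ->
  finite_set E -> ~ (E `<=` zeros H) ->
  (forall i, m E i -> m (set_mul F (m E)) (y * i)) -> m F y.
Proof.
move=> dM finE nE yE; apply: (modularization_local (@cl_idem _ m F)) => M MM.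
have pM := q_maxP MM.
have [e [Ee ne] [f nMf eE]] := discrete_finite pM (dM M MM) finE nE.
exists f => //.
have efE : m E `<=` colon (multiples e) [set f].
  apply: (@cl_min _ m) => [|z Ez _ ->]; last by rewrite mulC_canc; apply: eE.
  exact: (@ideal_colon _ m _ _ (ideal_multiples m e)).
have /(cl_scaled f) : m (set_mul F (m E)) (y * e) by apply/yE/(@sub_cl _ m).
have sub : m (mul f @` set_mul F (m E)) `<=` mul e @` m F.
  rewrite -cl_multiples_mul; apply: cl_mono => _ [_ [z Fz [w Ew <-]] <-].
  rewrite mulgCA set_mulC; apply: set_mulP => //.
  by rewrite mulC_canc; apply: efE.
move=> /sub[z Fz ez]; suff <- : z = f * y by [].
by apply: (canc_inj ne); rewrite ez; comm_mul.
Qed.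

Lemma SP_modularization :
  q_max r = q_max (t_system H) ->
  (forall X : set H, principal X -> nontrivial X ->
     q_invertible (t_system H) (radical X)) ->
  SP_monoid (modularization p r).
Proof.
move=> rt invR; apply: (SP_of_radical_generator p_le_r (ideal_zeros_set hHG r)).
move=> M x; rewrite rt => MM; apply: (radical_generator (hHG :=
  hHG)) => // z nz.
by apply: invR; [apply: principal_multiples | apply: nontrivial_multiples].
Qed.

Lemma SP_modularization_discrete : modular p ->
  SP_monoid (modularization p r) ->
  forall M, q_max r M -> discrete_at M.
Proof.
move=> modp SP M MM.
have MM' : q_max m M by rewrite -[q_max m]/(q_max (modularization p r)) modularization_max.
apply: (@SP_discrete_at _ m) => //.
- exact: modular_modularization.
- exact: ideal_zeros_set.
- exact: q_maxP.
- exact: max_nontrivial MM.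
Qed.

Lemma t_invertible_multiples x : ~ zeros H x ->
  q_invertible (t_system H) (multiples x).
Proof.
move=> nx; apply: (t_invertible_of_local (hHG := hHG)).
- exact: (ideal_multiples (t_ideal_system hHG)).
- by move=> /(_ x (multiples_refl x)).
move=> M /q_maxP[_ nM1 _]; exists x, 1; split=> // [|y]; last by rewrite mul1g.
exact: multiples_refl.
Qed.

End Equivalences.

Theorem theorem4p3 (H : cancMonoidType) (p r : ideal_system H)
    (hHG : ~ eq_quot_monoid H) (hp : modular p) (hpr : le_system p r) :
  [<-> almost_Dedekind r /\ SP_monoid r;
       q_max r = q_max (t_system H) /\
         (forall X : set H, principal X -> nontrivial X ->
            q_invertible (t_system H) (radical X));
       SP_monoid (modularization p r)]
  /\
  [<-> Bezout r /\ SP_monoid r;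
       q_max r = q_max (t_system H) /\
         (forall X : set H, principal X -> principal (radical X));
       Bezout (modularization p r) /\ SP_monoid (modularization p r)].
Proof.
have eqs := discrete_systems_eq hHG hpr.
have discrete := SP_modularization_discrete hHG hpr hp.
have invertible_of_principal :
    (forall X : set H, principal X -> principal (radical X)) ->
    forall X : set H, principal X -> nontrivial X ->
      q_invertible (t_system H) (radical X).
  move=> prinR X pX nX; have [|x nx ->] := nontrivial_principal (prinR X pX).
    split; first exact: subset_trans nX.1 (@sub_radical _ X).
    by move=> Rz; apply: nX.2; apply: subset_trans Rz; apply: sub_radical.
  exact: t_invertible_multiples.
split; tfae.
- move=> [/(almost_DedekindP hHG) dM SP]; have [rt _] := eqs dM.
  split; first by rewrite rt.
  move=> X pX nX; have [x nx ->] := nontrivial_principal pX nX.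
  exact: (SP_radical_t_invertible hHG rt SP dM nx).
- by move=> [rt invR]; apply: SP_modularization.
- move=> SP; have dM := discrete SP; have [rt mt] := eqs dM.
  by split; [apply/(almost_DedekindP hHG) | rewrite rt -mt].
- move=> [bezout SP]; split; first by rewrite (Bezout_eq_t hHG bezout).
  exact: (Bezout_radical_principal bezout SP).
- move=> [rt prinR].
  have SP := SP_modularization hHG hpr rt (invertible_of_principal prinR).
  have dM := discrete SP; have [_ mt] := eqs dM.
  split=> //; apply: (Bezout_of_principal_radicals hHG (q :=
    modularization_system p r)) => //.
  by move=> E F y; apply: discrete_cancel.
- by move=> [bezout SP]; have [rt mt] := eqs (discrete SP); rewrite rt -mt.
Qed.
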